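(* Let $d\ge1$, $\alpha\in(0,2]$, $p\in(0,1)$ with $\alpha p=1$, and let $t\in\mathbb{R}_+=[0,\infty)$. Let $(S_n)_{n\ge0}$ be the $d$-dimensional Shark Random Swim with memory parameter $p$ and stability parameter $\alpha$. Then, as $n\to\infty$, $$\left(\frac{1}{n^t\log(n)}\right)^{1/\alpha}S_{\lfloor n^t\rfloor}\longrightarrow t^{1/\alpha}\,\tilde S\quad\text{in distribution},$$ where $\tilde S$ is a $d$-dimensional isotropic $\alpha$-stable random variable with zero shift and scale parameter $((1-p)\Gamma(\alpha+1))^{1/\alpha}$, that is $$\mathbb{E}\left[e^{i\langle\theta,\tilde S\rangle}\right]=\exp\left(-(1-p)\Gamma(\alpha+1)\,\|\theta\|^\alpha\right),\qquad\theta\in\mathbb{R}^d .$$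
   Context: Let $\xi_1,\xi_2,\dots$ be i.i.d. $\mathbb{R}^d$-valued random variables that are standard isotropic strictly $\alpha$-stable: $\mathbb{E}[e^{i\langle\theta,\xi_1\rangle}]=e^{-\|\theta\|^\alpha}$ for all $\theta\in\mathbb{R}^d$, with $\|\cdot\|$ the Euclidean norm. The Shark Random Swim is defined by steps $Y_1=\xi_1$ and, for $n\ge2$: with probability $p$, an index $U_n$ is chosen uniformly in $\{1,\dots,n-1\}$ and $Y_n=Y_{U_n}$; with probability $1-p$, $Y_n=\xi_n$. All these random choices are independent of each other and of the $\xi_i$. Set $S_0=0$ and $S_n=\sum_{i=1}^nY_i$. $\Gamma$ is the Gamma function. *)

(* Defs.v *)
From HB Require Import structures.
From mathcomp Require Import all_boot all_order all_algebra.
From mathcomp Require Import complex.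
From mathcomp Require Import all_classical all_reals all_analysis.

Set Implicit Arguments.
Unset Strict Implicit.
Unset Printing Implicit Defensive.

Import Order.TTheory GRing.Theory Num.Theory.
Import numFieldNormedType.Exports.

Local Open Scope classical_set_scope.
Local Open Scope ring_scope.

(* R^dim as row vectors with the Borel sigma-algebra. The library norm on
   matrices is the sup norm; it induces the usual topology, but the Euclidean
   norm must be written out. *)
Notation borel_rV R dim := (g_sigma_algebraType (@open 'rV[R]_dim)).

Definition inner (R : realType) (dim : nat) (u v : 'rV[R]_dim) : R :=
  \sum_(i < dim) u 0 i * v 0 i.

Definition enorm (R : realType) (dim : nat) (u : 'rV[R]_dim) : R :=
  Num.sqrt (inner u u).

Definition Gamma (R : realType) (x : R) : R :=
  \int[lebesgue_measure]_(s in `]0, +oo[) (s `^ (x - 1) * expR (- s)).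

Definition expi (R : realType) (x : R) : R[i] := (cos x +i* sin x)%C.

Definition Cexpectation (d : measure_display) (T : measurableType d)
    (R : realType) (P : probability T R) (f : T -> R[i]) : R[i] :=
  ((\int[P]_w complex.Re (f w)) +i* (\int[P]_w complex.Im (f w)))%C.

Definition charfun (d : measure_display) (T : measurableType d)
    (R : realType) (P : probability T R) (dim : nat) (X : T -> 'rV[R]_dim)
    (theta : 'rV[R]_dim) : R[i] :=
  Cexpectation P (fun w => expi (inner theta (X w))).

Definition cvg_in_distribution (R : realType) (dim : nat)
    (d : measure_display) (T : measurableType d) (P : probability T R)
    (X : nat -> T -> 'rV[R]_dim)
    (d' : measure_display) (T' : measurableType d') (Q : probability T' R)
    (Z : T' -> 'rV[R]_dim) : Prop :=
  forall f : 'rV[R]_dim -> R, continuous f -> bounded_fun f ->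
    ('E_P[f \o X n] @[n --> \oo] --> 'E_Q[f \o Z])%E.

Definition sigma_of (d : measure_display) (T : measurableType d)
    (d' : measure_display) (T' : measurableType d') (X : T -> T') :
    set (set T) :=
  preimage_set_system setT X measurable.

(* Mutual independence of the families (F i), i ranging over D. *)
Definition independent_families (d : measure_display) (T : measurableType d)
    (R : realType) (P : probability T R) (I : eqType) (D : set I)
    (F : I -> set (set T)) : Prop :=
  forall (J : seq I) (A : I -> set T), uniq J ->
    (forall i, i \in J -> D i /\ F i (A i)) ->
    P (\bigcap_(i in [set` J]) A i) = (\prod_(i <- J) P (A i))%E.

Inductive source : Type :=
  | Step of nat
  | Coin of nat
  | Index of nat.
HB.instance Definition _ := gen_eqMixin source.

(* xi is indexed from 1, eps and U from 2; nothing is assumed on their values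
   at smaller indices, so independence is only required on this set. *)
Definition used_source : set source := [set s |
  match s with
  | Step n => (1 <= n)%N
  | Coin n => (2 <= n)%N
  | Index n => (2 <= n)%N
  end].

(* eps n is the coin deciding whether step n repeats the earlier step U n. The
   equations determine Y on indices >= 1 because 1 <= U n < n holds surely. *)
Record shark_random_swim (R : realType) (dim : nat) (alpha p : R)
    (d : measure_display) (T : measurableType d) (P : probability T R)
    (xi : nat -> {RV P >-> borel_rV R dim})
    (eps : nat -> {RV P >-> bool})
    (U : nat -> {RV P >-> nat})
    (Y S : nat -> T -> 'rV[R]_dim) : Prop := {
  srs_xi_charfun : forall theta : 'rV[R]_dim,
    charfun P (xi 1%N) theta = ((expR (- (enorm theta `^ alpha)))%:C)%C;
  srs_xi_identically_distributed :
    forall (n : nat) (B : set (borel_rV R dim)), (1 <= n)%N -> measurable B ->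
      distribution P (xi n) B = distribution P (xi 1%N) B;
  srs_eps : forall n : nat, (2 <= n)%N -> P [set w | eps n w = true] = p%:E;
  srs_U_range : forall (n : nat) (w : T), (2 <= n)%N -> (1 <= U n w < n)%N;
  srs_U_uniform : forall n k : nat, (2 <= n)%N -> (1 <= k < n)%N ->
    P [set w | U n w = k] = ((n.-1%:R)^-1)%:E;
  srs_independent : independent_families P used_source (fun s =>
    match s with
    | Step n => sigma_of (xi n)
    | Coin n => sigma_of (eps n)
    | Index n => sigma_of (U n)
    end);
  srs_Y1 : forall w : T, Y 1%N w = xi 1%N w;
  srs_Y : forall (n : nat) (w : T), (2 <= n)%N ->
    Y n w = if eps n w then Y (U n w) w else xi n w;
  srs_S : forall (n : nat) (w : T), S n w = \sum_(1 <= i < n.+1) Y i w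
}.

(* Main.v *)
Require Import Defs.
From HB Require Import structures.
From mathcomp Require Import all_boot all_order all_algebra.
From mathcomp Require Import complex.
From mathcomp Require Import all_classical all_reals all_analysis.
From mathcomp Require Import measurable_realfun.
From mathcomp Require Import ring lra zify.

Set Implicit Arguments.
Unset Strict Implicit.
Unset Printing Implicit Defensive.

Import Order.TTheory GRing.Theory Num.Theory.
Import numFieldNormedType.Exports.

Local Open Scope classical_set_scope.
Local Open Scope ring_scope.

(** Every step copies, directly or through intermediate copies, exactly one innovation
    [xi_j]; the steps copying the same innovation form a cluster.  Given the coins and indices,
    [S_n] is the sum of [c_j xi_j] over the clusters, [c_j] being the cluster sizes, so that
    strict stability gives
      E exp(i <theta, S_n>) = E exp(- |theta|^alpha W_n),   W_n = sum_j c_j^alpha.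
    The whole theorem is therefore a weak law of large numbers for [W_n],
      W_n / (n ln n) --> (1 - p) Gamma(alpha + 1)   in L^1,
    followed by a continuity theorem for characteristic functions.

    The law of large numbers.  A cluster of size [c] grows at time [n + 1] with probability
    [p c / n], and a new cluster appears with probability [1 - p].  The power [c^alpha] is
    replaced by [Gamma(c + alpha) / Gamma(c)], a multiple of [asc alpha c], because its
    increment is exactly [alpha / c] times itself: with [alpha p = 1] the sum [V_n] of the
    [asc alpha c_j] has conditional drift [V_n / n + (1 - p)], hence
    [E V_n = n (p + (1 - p) (1 + 1/2 + ... + 1/n))] ([tree_mean_asc]).  The same computation
    for the exponent [2 alpha], whose sum has mean at most [n^2], controls the square of the
    increments and yields [Var V_n <= 3 n^2 (1 + ... + 1/n)] ([tree_mean_asc_var]), which is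
    negligible against [(n ln n)^2].  Replacing the power costs only [O(n)] in total, since
    [|c^alpha - Gamma(alpha + 1) asc alpha c| <= c] ([powR_asc_le]); this is where the constant
    [Gamma(alpha + 1)] enters.

    The characteristic function.  [mean_trig_swim] expresses the mean of the cosine and sine of
    [<theta, S_n>] through [tree_mean], the expectation of a functional of the genealogy
    written as a finite recursion.

    The continuity theorem.  [levy_continuity] is proved for laws satisfying
    [E (1 - cos (v X_i)) <= C v] for small [v], a bound available here because [alpha >= 1].
    It gives uniform tails by summing over dyadic shells ([tail_bound]).  On a large box a
    bounded continuous function is approximated by trigonometric polynomials with the same
    global bound ([trig_approx]), and for these the convergence of the means is the
    convergence of the characteristic functions.  The pointwise limits of such polynomials
    also show that a continuous function of [S_n] is measurable. *)

(** * A discrete summation kernel on the circle *)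

Section grid.
Context {R : realType}.
Implicit Types (u v b : R).

(** Multiplied by [2 sin (pi k / M)], which is nonzero as [0 < k < M], the sum telescopes. *)
Lemma sum_cos_grid (M k : nat) u : (0 < k < M)%N ->
  \sum_(j < M) cos (k%:R * (u - 2 * pi * j%:R / M%:R)) = 0.
Proof.
move=> /andP[k0 kM]; have M0 : 0 < M%:R :> R by rewrite ltr0n (leq_trans _ kM).
have kR : 0 < k%:R :> R by rewrite ltr0n.
pose h : R := pi * k%:R / M%:R.
have sh : sin h != 0.
  rewrite gt_eqF// sin_gt0_pi// /h !mulr_gt0 ?pi_gt0 ?invr_gt0//=.
  by rewrite ltr_pdivrMr// ltr_pM2l ?pi_gt0// ltr_nat.
apply: (mulfI (mulf_neq0 (lt0r_neq0 (ltr0Sn R 1)) sh)); rewrite mulr0 mulr_sumr.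
pose g (j : nat) := sin (k%:R * u + h - 2 * h * j%:R).
rewrite (eq_bigr (fun j : 'I_M => g j - g j.+1)); last first.
  move=> j _; rewrite /g.
  have -> : k%:R * (u - 2 * pi * j%:R / M%:R) = k%:R * u - 2 * h * j%:R.
    by rewrite /h; field; rewrite gt_eqF.
  rewrite (_ : k%:R * u + h - 2 * h * j%:R = (k%:R * u - 2 * h * j%:R) + h); last by ring.
  rewrite (_ : k%:R * u + h - 2 * h * j.+1%:R = (k%:R * u - 2 * h * j%:R) - h);
    last by rewrite -[j.+1%:R]natr1; ring.
  move: (k%:R * u - 2 * h * j%:R) => X; rewrite sinD sinB; ring.
rewrite -(big_mkord xpredT (fun j => g j - g j.+1)).
have -> : \sum_(0 <= j < M) (g j - g j.+1) = g 0%N - g M.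
  by rewrite -opprB -(telescope_sumr g (leq0n M)) -sumrN; apply: eq_bigr => j _; rewrite opprB.
rewrite /g mulr0 subr0.
have -> : k%:R * u + h - 2 * h * M%:R = k%:R * u + h - (pi *+ 2) *+ k.
  by rewrite /h -[pi *+ 2 *+ k]mulr_natl -[pi *+ 2]mulr_natl; field; rewrite gt_eqF.
rewrite -[in X in X - _](subrK ((pi *+ 2) *+ k) (k%:R * u + h)).
by rewrite (periodicn (@sinD2pi R)) subrr.
Qed.

(** A nonnegative trigonometric polynomial of degree [N] that concentrates at the multiples of
    [2 pi] as [N] grows. *)
Definition cosker (N : nat) u : R := ((1 + cos u) / 2) ^+ N.

Lemma cosker_ge0 N u : 0 <= cosker N u.
Proof. by rewrite exprn_ge0// divr_ge0//; have := cos_geN1 u; lra. Qed.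

(** The Fourier coefficients of [cosker N]. *)
Definition coscoef (N k : nat) : R := 'C(2 * N, N + k)%:R / 4 ^+ N.

Lemma coscoefS N k : coscoef N.+1 k.+1 =
  coscoef N k.+1 / 2 + (coscoef N k.+2 + coscoef N k) / 4.
Proof.
rewrite /coscoef (_ : (2 * N.+1 = (2 * N).+2)%N); last by lia.
rewrite (_ : (N.+1 + k.+1 = (N + k).+2)%N); last by lia.
rewrite (_ : (N + k.+1 = (N + k).+1)%N); last by lia.
rewrite (_ : (N + k.+2 = (N + k).+2)%N); last by lia.
rewrite binS binS (binS _ (N + k)) !natrD exprS; field.
by rewrite expf_neq0.
Qed.

Lemma coscoefS0 N : coscoef N.+1 0 = coscoef N 0 / 2 + coscoef N 1 / 2.
Proof.
rewrite /coscoef (_ : (2 * N.+1 = (2 * N).+2)%N); last by lia.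
rewrite !addn0 binS.
case: N => [|N].
  rewrite muln0 !bin0 ?bin1 ?bin_small//. rewrite expr1 expr0; lra.
have : 'C(2 * N.+1, N) = 'C(2 * N.+1, N.+2).
  by rewrite -bin_sub; [congr binomial|]; lia.
rewrite addn1; move: (2 * N.+1)%N => m E.
rewrite (binS m N.+1) (binS m N) E !natrD.
by rewrite [in LHS]exprS; field; rewrite expf_neq0.
Qed.

Lemma coscoef1 N : N.+1%:R * coscoef N 1 = N%:R * coscoef N 0.
Proof.
rewrite /coscoef addn0 addn1 !mulrA -!natrM mul_bin_left.
by rewrite (_ : (2 * N - N = N)%N)//; lia.
Qed.

Lemma coscoef0_gt0 N : 0 < coscoef N 0.
Proof. by rewrite divr_gt0 ?exprn_gt0// ltr0n bin_gt0; lia. Qed.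

(** A trigonometric polynomial of degree less than [M] has the same average over every
    translate of the grid of [M] equidistant angles, namely its constant coefficient; here it is
    applied to [cosker N] times a cosine, of degree [N + k].  This is why
    grid sums can replace integrals, each term remaining a trigonometric polynomial in [u]. *)
Lemma sum_cosker_grid (M N k : nat) u : (N + k < M)%N ->
  \sum_(j < M) cosker N (u - 2 * pi * j%:R / M%:R) *
     cos (k%:R * (u - 2 * pi * j%:R / M%:R)) = M%:R * coscoef N k.
Proof.
elim: N k => [|N IH] k NkM.
  rewrite /coscoef muln0 expr0 add0n divr1.
  under eq_bigr do rewrite /cosker expr0 mul1r.
  case: k NkM => [|k] NkM; last by rewrite sum_cos_grid// mulr0.
  under eq_bigr do rewrite mul0r cos0.
  by rewrite sumr_const card_ord mulr1.
case: k NkM => [|k] NkM.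
  have h0 := IH 0%N; have h1 := IH 1%N.
  rewrite [RHS](_ : _ = M%:R * coscoef N 0 / 2 + M%:R * coscoef N 1 / 2); last first.
    by rewrite coscoefS0; ring.
  rewrite -h0 -?h1; [|lia..].
  rewrite 2!mulr_suml -big_split/=; apply: eq_bigr => j _.
  rewrite mul1r !mul0r cos0 /cosker exprS.
  by field.
have h1 := IH k.+1; have h2 := IH k.+2; have h0 := IH k.
rewrite [RHS](_ : _ = M%:R * coscoef N k.+1 / 2 +
    (M%:R * coscoef N k.+2 + M%:R * coscoef N k) / 4); last first.
  by rewrite coscoefS; ring.
rewrite -h0 -?h1 -?h2; [|lia..].
rewrite -big_split/= 2!mulr_suml -big_split/=; apply: eq_bigr => j _.
move: (u - _) => w.
have -> : k.+2%:R * w = k.+1%:R * w + w by rewrite -[k.+2%:R]natr1; ring.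
have -> : k%:R * w = k.+1%:R * w - w by rewrite -[k.+1%:R]natr1; ring.
by rewrite cosD cosB /cosker exprS; field.
Qed.

(** Normalised so that the weights at the [N + 2] grid angles sum to 1; the grid needs more
    than [N + 1] points because the first moment involves a polynomial of degree [N + 1]. *)
Definition gridweight (N : nat) u : R := cosker N u / (N.+2%:R * coscoef N 0).

Lemma gridweight_ge0 N u : 0 <= gridweight N u.
Proof. by rewrite divr_ge0 ?cosker_ge0// mulr_ge0// ltW// coscoef0_gt0. Qed.

Let pos N : 0 < N.+2%:R * coscoef N 0 :> R.
Proof. by rewrite mulr_gt0 ?coscoef0_gt0. Qed.

Lemma sum_gridweight N u :
  \sum_(j < N.+2) gridweight N (u - 2 * pi * j%:R / N.+2%:R) = 1.
Proof.
rewrite -mulr_suml; have /(_ u) := @sum_cosker_grid N.+2 N 0.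
rewrite addn0 => /(_ (ltnW (ltnSn _))).
under eq_bigr do rewrite mul0r cos0 mulr1.
by move=> ->; rewrite mulfV// gt_eqF.
Qed.

(** The weights concentrate at angle 0: the ratio of the first two coefficients of [cosker N]
    is [N / (N + 1)]. *)
Lemma sum_gridweight_cos N u :
  \sum_(j < N.+2) gridweight N (u - 2 * pi * j%:R / N.+2%:R) *
     (1 - cos (u - 2 * pi * j%:R / N.+2%:R)) = N.+1%:R^-1.
Proof.
under eq_bigr do rewrite mulrBr mulr1.
rewrite sumrB sum_gridweight.
under eq_bigr do rewrite mulrAC.
rewrite -mulr_suml; have /(_ u) := @sum_cosker_grid N.+2 N 1.
rewrite addn1 => /(_ (ltnSn _)).
under eq_bigr do rewrite mul1r.
move=> ->.
have c0 := coscoef0_gt0 N.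
have -> : coscoef N 1 = N%:R / N.+1%:R * coscoef N 0.
  apply: (mulfI (_ : N.+1%:R != 0)); rewrite ?pnatr_eq0// coscoef1.
  by field; rewrite ?nat1r ?natr1 pnatr_eq0.
have n1 : N%:R + 1 != 0 :> R by rewrite natr1 pnatr_eq0.
have : N.+2%:R != 0 :> R by rewrite pnatr_eq0.
rewrite -[N.+1%:R]natr1; move: (N.+2%:R) (N%:R : R) (coscoef N 0) c0 n1 => M n c c0 n1 M0.
by field; rewrite n1 M0 gt_eqF.
Qed.

End grid.

(** * Trigonometric approximation of continuous functions *)

Section trigpoly.
Context {R : realType} {dim : nat}.
Implicit Types (x y z : 'rV[R]_dim) (f g : 'rV[R]_dim -> R).

(** The linear span of the functions [cos (<theta, x> + b)].  The phase [b] makes the sines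
    members, and the product formula makes the span closed under multiplication. *)
Inductive trigpoly : ('rV[R]_dim -> R) -> Prop :=
| trigpoly_cos (theta : 'rV[R]_dim) (b : R) :
    trigpoly (fun x => cos (inner theta x + b))
| trigpoly_add f g : trigpoly f -> trigpoly g -> trigpoly (fun x => f x + g x)
| trigpoly_scale (c : R) f : trigpoly f -> trigpoly (fun x => c * f x).

Lemma innerDl (u v x : 'rV[R]_dim) : inner (u + v) x = inner u x + inner v x.
Proof. by rewrite /inner -big_split; apply: eq_bigr => i _; rewrite mxE mulrDl. Qed.

Lemma innerZl c (u x : 'rV[R]_dim) : inner (c *: u) x = c * inner u x.
Proof. by rewrite /inner mulr_sumr; apply: eq_bigr => i _; rewrite mxE mulrA. Qed.

Lemma innerDr (u x y : 'rV[R]_dim) : inner u (x + y) = inner u x + inner u y.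
Proof. by rewrite /inner -big_split; apply: eq_bigr => i _; rewrite mxE mulrDr. Qed.

Lemma innerZr c (u x : 'rV[R]_dim) : inner u (c *: x) = c * inner u x.
Proof.
rewrite /inner mulr_sumr; apply: eq_bigr => i _.
by rewrite mxE mulrCA.
Qed.

Lemma inner0l x : inner 0 x = 0.
Proof. by rewrite /inner big1// => i _; rewrite mxE mul0r. Qed.

Lemma inner_delta i x : inner (delta_mx 0 i) x = x 0 i.
Proof.
rewrite /inner (bigD1 i)//= mxE !eqxx mul1r big1 ?addr0// => j ji.
by rewrite mxE (negbTE ji) mul0r.
Qed.

Lemma trigpoly_cst (c : R) : trigpoly (fun=> c).
Proof.
have -> : (fun=> c) = (fun x => c * cos (inner 0 x + 0)).
  by apply/funext => x; rewrite inner0l addr0 cos0 mulr1.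
exact/trigpoly_scale/trigpoly_cos.
Qed.

Lemma trigpoly_mul f g : trigpoly f -> trigpoly g -> trigpoly (fun x => f x * g x).
Proof.
move=> tf tg; elim: tf => [u b|f1 f2 _ IH1 _ IH2|c f1 _ IH].
- elim: tg => [v c|g1 g2 _ IH1 _ IH2|c g1 _ IH].
  + have -> : (fun x => cos (inner u x + b) * cos (inner v x + c)) =
      (fun x => 2^-1 * cos (inner (u + v) x + (b + c)) +
                2^-1 * cos (inner (u + (-1) *: v) x + (b - c))).
      apply/funext => x; rewrite !innerDl innerZl.
      rewrite (_ : inner u x + inner v x + (b + c) =
        (inner u x + b) + (inner v x + c)); last by ring.
      rewrite (_ : inner u x + -1 * inner v x + (b - c) =
        (inner u x + b) - (inner v x + c)); last by ring.
      by move: (inner u x + b) (inner v x + c) => A B; rewrite cosD cosB; field.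
    by apply: trigpoly_add; exact/trigpoly_scale/trigpoly_cos.
  + under eq_fun do rewrite mulrDr; exact: trigpoly_add.
  + under eq_fun do rewrite mulrCA; exact: trigpoly_scale.
- under eq_fun do rewrite mulrDl; exact: trigpoly_add.
- under eq_fun do rewrite -mulrA; exact: trigpoly_scale.
Qed.

Lemma trigpoly_exp f N : trigpoly f -> trigpoly (fun x => f x ^+ N).
Proof.
move=> tf; elim: N => [|N IH]; first by under eq_fun do rewrite expr0; exact: trigpoly_cst.
by under eq_fun do rewrite exprS; exact: trigpoly_mul.
Qed.

Lemma trigpoly_sum (I : Type) (r : seq I) (F : I -> 'rV[R]_dim -> R) :
  (forall i, trigpoly (F i)) -> trigpoly (fun x => \sum_(i <- r) F i x).
Proof.
move=> tF; elim: r => [|i r IH].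
  by under eq_fun do rewrite big_nil; exact: trigpoly_cst.
by under eq_fun do rewrite big_cons; exact: trigpoly_add.
Qed.

Lemma trigpoly_prod (I : Type) (r : seq I) (F : I -> 'rV[R]_dim -> R) :
  (forall i, trigpoly (F i)) -> trigpoly (fun x => \prod_(i <- r) F i x).
Proof.
move=> tF; elim: r => [|i r IH].
  by under eq_fun do rewrite big_nil; exact: trigpoly_cst.
by under eq_fun do rewrite big_cons; exact: trigpoly_mul.
Qed.

Lemma trigpoly_gridweight N (L c : R) i :
  trigpoly (fun x => gridweight N (x 0 i / L - c)).
Proof.
rewrite /gridweight /cosker.
have -> : (fun x => ((1 + cos (x 0 i / L - c)) / 2) ^+ N / (N.+2%:R * coscoef N 0)) =
  (fun x => (N.+2%:R * coscoef N 0)^-1 *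
    (2^-1 * (1 + cos (inner (L^-1 *: delta_mx 0 i) x + - c))) ^+ N).
  apply/funext => x; rewrite innerZl inner_delta mulrC; congr (_ * _ ^+ _).
  by rewrite mulrC (mulrC (x 0 i)).
apply/trigpoly_scale/trigpoly_exp/trigpoly_scale/trigpoly_add.
  exact: trigpoly_cst.
exact: trigpoly_cos.
Qed.

End trigpoly.

Section approximation.
Context {R : realType} {dim : nat}.
Implicit Types (x y z : 'rV[R]_dim) (f g : 'rV[R]_dim -> R).

(** For [|u|] between [pi] and [3 pi / 2] the cosine is nonpositive; below [pi] it is monotone. *)
Lemma cos_gap (delta u : R) : 0 < delta -> delta <= 1 ->
  delta <= `|u| <= pi + pi / 2 -> Num.min 1 (1 - cos delta) <= 1 - cos u.
Proof.
move=> d0 d1 /andP[du ul]; rewrite -[cos u]cos_norm.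
have pi2 := @pi_ge2 R.
have [up|up] := leP `|u| pi.
  rewrite ge_min; apply/orP; right; rewrite lerD2l lerN2.
  move: du; rewrite le_eqVlt => /predU1P[->//|du].
  by apply: ltW; rewrite ltr_cos// in_itv/=; apply/andP; split => //; lra.
rewrite ge_min; apply/orP; left; rewrite lerBrDr gerDl -oppr_ge0.
have -> : - cos `|u| = cos (`|u| - pi).
  by rewrite -[in LHS](subrK pi `|u|) cosDpi opprK.
apply: cos_ge0_pihalf; apply/andP; split; lra.
Qed.

(** A Heine theorem in which only [y] has to stay in the compact set. *)
Lemma unif_continuous_on (A : set 'rV[R]_dim) f (e : R) : compact A -> continuous f ->
  0 < e -> exists2 delta : R, 0 < delta &
    forall y z, A y -> `|y - z| < delta -> `|f y - f z| <= e.
Proof.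
move=> cA cf e0.
have /compact_near_coveringP := cA.
pose Q (delta : R) (y : 'rV[R]_dim) := forall z, `|y - z| < delta -> `|f y - f z| <= e.
move=> /(_ R (0 : R)^'+ Q _) nc.
have H : \forall delta \near (0 : R)^'+, A `<=` Q delta.
  apply: nc => y Ay.
  have e2 : 0 < e / 2 by rewrite divr_gt0.
  have /cvgrPdist_lt /(_ _ e2) := cf y.
  rewrite -nbhs_ballE => -[rho /= rho0 Hrho].
  have r2 : 0 < rho / 2 by rewrite divr_gt0.
  exists (ball y (rho / 2), [set delta : R | delta < rho / 2]).
    split => /=; first exact: nbhsx_ballx.
    exact: nbhs_right_lt.
  move=> [y' delta] /= [yy' dr] z y'z.
  have h1 : `|f y - f y'| < e / 2.
    by apply: Hrho; apply: le_ball yy'; lra.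
  have h2 : `|f y - f z| < e / 2.
    apply: Hrho; rewrite -ball_normE/= in yy' *.
    rewrite (_ : y - z = (y - y') + (y' - z)); last by rewrite addrA subrK.
    by rewrite (le_lt_trans (ler_normD _ _))//; lra.
  rewrite (_ : f y' - f z = (f y - f z) - (f y - f y')); last by ring.
  by rewrite (le_trans (ler_normB _ _))//; lra.
near (0 : R)^'+ => delta.
  exists delta; first by near: delta; exact: nbhs_right_gt.
  suff HA : A `<=` Q delta by move=> y z Ay; exact: HA.
  by near: delta; exact: H.
Unshelve. all: end_near. Qed.

Lemma coord_lt_norm (y : 'rV[R]_dim) (e : R) : 0 < e -> (forall i, `|y 0 i| < e) -> `|y| < e.
Proof.
move=> e0 H; rewrite [ltLHS]/Num.Def.normr/= mx_normrE.
by apply/bigmax_ltP; split => //= -[i j] _; rewrite (ord1 i); exact: H.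
Qed.

(** Centred: the angles run from [- pi] included to [pi] excluded. *)
Definition gridangle (N : nat) (j : 'I_N.+2) : R := 2 * pi * j%:R / N.+2%:R - pi.

Definition gridpoint (N : nat) (L : R) (g : {ffun 'I_dim -> 'I_N.+2}) : 'rV[R]_dim :=
  \row_i (L * gridangle (g i)).

Definition gridcoef (N : nat) (L : R) y (g : {ffun 'I_dim -> 'I_N.+2}) : R :=
  \prod_i gridweight N (y 0 i / L - gridangle (g i)).

Lemma gridcoef_ge0 N L y (h : {ffun 'I_dim -> 'I_N.+2}) : 0 <= gridcoef L y h.
Proof. by apply: prodr_ge0 => i _; exact: (@gridweight_ge0 R N). Qed.

Let gridangleE N (u : R) (j : 'I_N.+2) :
  u - gridangle j = (u + pi) - 2 * pi * j%:R / N.+2%:R.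
Proof. by rewrite /gridangle; ring. Qed.

Lemma sum_gridcoef N L y : \sum_(g : {ffun 'I_dim -> 'I_N.+2}) gridcoef L y g = 1.
Proof.
rewrite -(bigA_distr_bigA (fun i j => gridweight N (y 0 i / L - gridangle j))).
rewrite big1// => i _; under eq_bigr do rewrite gridangleE.
exact: sum_gridweight.
Qed.

(** The product weights have unit mass in each factor, so only the [i]-th factor contributes. *)
Lemma sum_gridcoef_cos N L y i :
  \sum_(g : {ffun 'I_dim -> 'I_N.+2}) gridcoef L y g *
    (1 - cos (y 0 i / L - gridangle (g i))) = N.+1%:R^-1.
Proof.
pose F k j := if k == i then
  gridweight N (y 0 k / L - @gridangle N j) * (1 - cos (y 0 k / L - gridangle j))
  else gridweight N (y 0 k / L - gridangle j).
transitivity (\sum_(g : {ffun 'I_dim -> 'I_N.+2}) \prod_k F k (g k)).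
  apply: eq_bigr => g _; rewrite /gridcoef (bigD1 i)//= [RHS](bigD1 i)//= /F eqxx.
  rewrite mulrAC; congr (_ * _); apply: eq_bigr => k ki.
  by rewrite (negbTE ki).
rewrite -(bigA_distr_bigA F) (bigD1 i)//= [X in _ * X]big1 ?mulr1; last first.
  move=> k ki; rewrite /F (negbTE ki); under eq_bigr do rewrite gridangleE.
  exact: sum_gridweight.
rewrite /F eqxx; under eq_bigr do rewrite gridangleE.
exact: sum_gridweight_cos.
Qed.

Lemma gridangle_bound N (j : 'I_N.+2) : `|gridangle j| <= pi.
Proof.
rewrite /gridangle ler_norml; apply/andP; split.
  by rewrite lerBrDr addrC subrr !mulr_ge0 ?pi_ge0// invr_ge0.
rewrite lerBlDr ler_pdivrMr ?ltr0n//.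
rewrite (_ : pi + pi = 2 * pi); last by ring.
by rewrite ler_wpM2l ?mulr_ge0 ?pi_ge0// ler_nat ltnW.
Qed.

(** Average [f] over a grid of one period with the product weights centred at [y].  The weights
    are nonnegative with sum 1, which gives the global bound [B].  The period [2 pi L] is chosen
    with [L >= r], so that for [y] in the box and [z] in the fundamental cube the angle
    [(y_i - z_i) / L] is at most [3 pi / 2]: it can then be close to a multiple of [2 pi] only
    when [y_i] is close to [z_i].  Grid points far from [y] have total weight [O(1 / N)] by a
    Chebyshev estimate on [1 - cos]. *)
Lemma trig_approx f (B r e : R) : continuous f -> (forall x, `|f x| <= B) -> 0 < e ->
  exists g, [/\ trigpoly g, forall y, `|g y| <= B &
    forall y, (forall i, `|y 0 i| <= r) -> `|g y - f y| <= e].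
Proof.
(* the angles y_i / L are then at most 1, hence below pi / 2 *)
move=> cf fB e0; pose L := Num.max r 1.
have L1 : 1 <= L by rewrite le_max lexx orbT.
have L0 : 0 < L by lra.
have rL : r <= L by rewrite le_max lexx.
have B0 : 0 <= B by exact: le_trans (normr_ge0 _) (fB 0).
have cA : compact [set y : 'rV[R]_dim | forall i, y 0 i \in `[(- r), r]].
  apply: (@rV_compact _  _ (fun=> `[(- r), r]%classic)) => _.
  exact: segment_compact.
have e2 : 0 < e / 2 by rewrite divr_gt0.
have [delta d0 Hd] := unif_continuous_on cA cf e2.
pose del := Num.min (delta / L) 1.
have del0 : 0 < del by rewrite lt_min divr_gt0//=.
have del1 : del <= 1 by rewrite ge_min lexx orbT.
pose eta := Num.min 1 (1 - cos del).
have eta0 : 0 < eta.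
  rewrite lt_min ltr01 subr_gt0 -cos0 ltr_cos// in_itv/= ?lexx ?pi_ge0//.
  by rewrite ltW//=; have := @pi_ge2 R; lra.
pose N := Num.truncn (2 * B * dim%:R / eta / (e / 2)).
exists (fun y => \sum_(g : {ffun 'I_dim -> 'I_N.+2}) gridcoef L y g * f (gridpoint L g)).
split.
- apply: trigpoly_sum => g; under eq_fun do rewrite mulrC.
  by apply/trigpoly_scale/trigpoly_prod => i; exact: trigpoly_gridweight.
- move=> y; apply: (le_trans (ler_norm_sum _ _ _)).
  rewrite -[leRHS]mul1r -(sum_gridcoef N L y) mulr_suml; apply: ler_sum => g _.
  by rewrite normrM ger0_norm ?gridcoef_ge0// ler_wpM2l ?gridcoef_ge0.
move=> y yr.
rewrite -[X in _ - X]mul1r -(sum_gridcoef N L y) mulr_suml -sumrB.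
under eq_bigr do rewrite -mulrBr.
apply: (le_trans (ler_norm_sum _ _ _)).
pose u (g : {ffun 'I_dim -> 'I_N.+2}) i : R := y 0 i / L - gridangle (g i).
apply: (@le_trans _ _ (\sum_(g : {ffun 'I_dim -> 'I_N.+2}) (gridcoef L y g * (e / 2) +
   2 * B / eta * \sum_i (gridcoef L y g * (1 - cos (u g i)))))).
  apply: ler_sum => g _.
  rewrite normrM ger0_norm ?gridcoef_ge0//.
  rewrite [leRHS](_ : _ = gridcoef L y g * (e / 2 + 2 * B / eta * \sum_i (1 - cos (u g i))));
    last by rewrite -mulr_sumr; ring.
  rewrite ler_wpM2l ?gridcoef_ge0//.
  have uge0 i : 0 <= 1 - cos (u g i) by rewrite subr_ge0 cos_le1.
  have c0 : 0 <= 2 * B / eta by rewrite divr_ge0 ?mulr_ge0// ltW.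
  have [small|] := pselect (forall i, `|(y - gridpoint L g) 0 i| < delta).
    rewrite distrC; apply: (@le_trans _ _ (e / 2)).
      apply: Hd; last exact: coord_lt_norm.
      by move=> i; rewrite /= in_itv/= -ler_norml.
    by rewrite lerDl mulr_ge0// sumr_ge0.
  move=> /existsNP[i /negP]; rewrite -leNgt => big.
  apply: (@le_trans _ _ (2 * B)).
    rewrite (le_trans (ler_normB _ _))//.
    by have := fB (gridpoint L g); have := fB y; move=> *; lra.
  apply: (@le_trans _ _ (2 * B / eta * (1 - cos (u g i)))); last first.
    apply: (@le_trans _ _ (2 * B / eta * \sum_k (1 - cos (u g k)))); last by rewrite lerDr ltW.
    by rewrite ler_wpM2l// (bigD1 i)//= lerDl sumr_ge0.
  rewrite -[leLHS](@divfK _ eta) ?gt_eqF//  ler_wpM2l//.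
  apply: cos_gap => //; apply/andP; split.
    rewrite ge_min; apply/orP; left; rewrite ler_pdivrMr//.
    apply: (le_trans big); rewrite !mxE -[X in _ <= _ * X](gtr0_norm L0) -normrM.
    by rewrite /u mulrBl divfK ?gt_eqF// (mulrC (gridangle _)).
  rewrite (le_trans (ler_normB _ _))// addrC lerD ?gridangle_bound//.
  rewrite normrM normfV (gtr0_norm L0) ler_pdivrMr//.
  have pi2 := @pi_ge2 R; have := yr i; have : L <= pi / 2 * L.
    by rewrite ler_peMl ?(ltW L0)//; lra.
  by move=> *; lra.
rewrite big_split/= -mulr_suml sum_gridcoef mul1r -mulr_sumr exchange_big/=.
under eq_bigr do rewrite sum_gridcoef_cos.
rewrite sumr_const card_ord -[_ *+ dim]mulr_natr.
have : 2 * B * dim%:R / eta / (e / 2) < N.+1%:R by exact: truncnS_gt.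
have N0 : 0 < N.+1%:R :> R by rewrite ltr0n.
rewrite ltr_pdivrMr// => H.
have : 2 * B * dim%:R / eta / N.+1%:R <= e / 2.
  by rewrite ler_pdivrMr// [leRHS]mulrC; exact: ltW.
rewrite (_ : 2 * B * dim%:R / eta / N.+1%:R = 2 * B / eta * (N.+1%:R^-1 * dim%:R)); last by ring.
by move=> h; rewrite [leRHS](splitr e) lerD2l.
Qed.

End approximation.

(** * Means of bounded measurable functions and tail bounds *)

Section bounded_measurable.
Context d (T : measurableType d) (R : realType) (P : probability T R).
Implicit Types (f g : T -> R) (A : set T).

(** The functions for which all means below exist and are linear. *)
Definition bmfun f := measurable_fun setT f /\ exists M, forall w, `|f w| <= M.

Local Notation E f := (\int[P]_w f w).

Lemma bmfun_integrable f : bmfun f -> P.-integrable setT (EFin \o f).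
Proof.
move=> [mf [M fM]]; apply: measurable_bounded_integrable => //.
  exact: le_lt_trans (probability_le1 _ measurableT) (ltry 1).
by exists M; split => [|x Mx w _ /=]; [exact: num_real|exact: le_trans (fM w) (ltW Mx)].
Qed.

Lemma bmfun_cst (c : R) : bmfun (cst c).
Proof. by split => //; exists `|c|. Qed.

Lemma bmfunD f g : bmfun f -> bmfun g -> bmfun (fun w => f w + g w).
Proof.
move=> [mf [M fM]] [mg [N gN]]; split; first exact: measurable_funD.
by exists (M + N) => w; rewrite (le_trans (ler_normD _ _))// lerD.
Qed.

Lemma bmfunM f g : bmfun f -> bmfun g -> bmfun (fun w => f w * g w).
Proof.
move=> [mf [M fM]] [mg [N gN]]; split; first exact: measurable_funM.
by exists (M * N) => w; rewrite normrM ler_pM.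
Qed.

Lemma bmfunZ (c : R) f : bmfun f -> bmfun (fun w => c * f w).
Proof. by move=> bf; apply: bmfunM => //; exact: bmfun_cst. Qed.

Lemma bmfunB f g : bmfun f -> bmfun g -> bmfun (fun w => f w - g w).
Proof.
move=> bf bg; have := bmfunD bf (bmfunZ (-1) bg).
by under eq_fun do rewrite mulN1r.
Qed.

Lemma bmfun_norm f : bmfun f -> bmfun (fun w => `|f w|).
Proof.
move=> [mf [M fM]]; split; first exact: measurableT_comp.
by exists M => w; rewrite normr_id.
Qed.

Lemma bmfun_cos f : measurable_fun setT f -> bmfun (fun w => cos (f w)).
Proof.
move=> mf; split; last by exists 1 => w; exact: cos_max.
by apply: measurableT_comp mf; apply: continuous_measurable_fun; exact: continuous_cos.
Qed.

Lemma bmfun_sin f : measurable_fun setT f -> bmfun (fun w => sin (f w)).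
Proof.
move=> mf; split; last by exists 1 => w; exact: sin_max.
by apply: measurableT_comp mf; apply: continuous_measurable_fun; exact: continuous_sin.
Qed.

Lemma bmfun_indic A : measurable A -> bmfun (\1_A).
Proof.
move=> mA; split; first exact: measurable_indic.
by exists 1 => w; rewrite indicE; case: (_ \in _); rewrite ?normr1 ?normr0.
Qed.

Lemma mean_cst (c : R) : E (cst c) = c.
Proof. by rewrite Rintegral_cst// [X in fine X](@probability_setT _ _ _ P) mulr1. Qed.

Lemma meanD f g : bmfun f -> bmfun g -> \int[P]_w (f w + g w) = E f + E g.
Proof. by move=> bf bg; rewrite RintegralD//; exact: bmfun_integrable. Qed.

Lemma meanB f g : bmfun f -> bmfun g -> \int[P]_w (f w - g w) = E f - E g.
Proof. by move=> bf bg; rewrite RintegralB//; exact: bmfun_integrable. Qed.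

Lemma meanZ (c : R) f : bmfun f -> \int[P]_w (c * f w) = c * E f.
Proof. by move=> bf; rewrite RintegralZl//; exact: bmfun_integrable. Qed.

Lemma le_mean f g : bmfun f -> bmfun g -> (forall w, f w <= g w) -> E f <= E g.
Proof. by move=> bf bg fg; apply: le_Rintegral => //; exact: bmfun_integrable. Qed.

Lemma ler_norm_mean f : bmfun f -> `|E f| <= \int[P]_w `|f w|.
Proof. by move=> bf; apply: le_normr_Rintegral => //; exact: bmfun_integrable. Qed.

Lemma mean_indic A : measurable A -> E (\1_A) = fine (P A).
Proof. by move=> mA; rewrite /Rintegral integral_indic// setIT. Qed.

Lemma mean_bound f M : bmfun f -> (forall w, `|f w| <= M) -> `|E f| <= M.
Proof.
move=> bf fM; rewrite (le_trans (ler_norm_mean bf))// -[leRHS]mean_cst.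
by apply: le_mean => //; [exact: bmfun_norm|exact: bmfun_cst].
Qed.

Lemma EFin_mean f : bmfun f -> (E f)%:E = ('E_P[f])%E.
Proof.
move=> bf; rewrite unlock fineK//; apply: integrable_fin_num => //.
exact: bmfun_integrable.
Qed.

End bounded_measurable.

Section tail.
Context d (T : measurableType d) (R : realType) (P : probability T R).

(** On the shell [2^k <= |x| < 2^(k + 1)] the number [2^(- k) |x|] lies between 1 and 2, where
    [1 - cos] is at least [1 - cos 1].  The hypothesis at [v = 2^(- k)] bounds the probability of
    the shell by a multiple of [2^(- k)], and these bounds form a geometric series. *)
Lemma tail_bound (x : T -> R) (C : R) (m : nat) : measurable_fun setT x ->
  (forall v, 0 < v <= 1 -> \int[P]_w (1 - cos (v * x w)) <= C * v) ->
  (P [set w | (2 ^+ m <= `|x w|)%R] <= (2 * C / (1 - cos 1) / 2 ^+ m)%:E)%E.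
Proof.
move=> mx xC; set kap := 1 - cos 1 : R.
have pi2 := @pi_ge2 R.
have kap0 : 0 < kap.
  rewrite subr_gt0 -[X in _ < X]cos0 ltr_cos// in_itv/= ?lexx ?ler01//; lra.
have mnx : measurable_fun setT (fun w => `|x w|) by exact: measurableT_comp.
pose A k := [set w | 2 ^+ (m + k) <= `|x w| /\ `|x w| < 2 ^+ (m + k).+1].
have mA k : measurable (A k).
  rewrite [A k](_ : _ = setT `&` (fun w => `|x w|) @^-1` `[2 ^+ (m + k), 2 ^+ (m + k).+1[).
    exact: mnx.
  by rewrite setTI; apply/seteqP; split => w /=; rewrite in_itv/= => /andP.
have mS : measurable [set w | 2 ^+ m <= `|x w|].
  rewrite (_ : mkset _ = setT `&` (fun w => `|x w|) @^-1` `[2 ^+ m, +oo[).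
    exact: mnx.
  by rewrite setTI; apply/seteqP; split => w /=; rewrite in_itv/= andbT.
have SA : [set w | 2 ^+ m <= `|x w|] `<=` \bigcup_k A k.
  move=> w /= mw.
  have ex : exists k, `|x w| < 2 ^+ (m + k).+1.
    exists (Num.truncn `|x w|); apply: (lt_le_trans (truncnS_gt _)).
    rewrite -natrX ler_nat; apply: (leq_trans (ltnW (ltn_expl _ (isT : 1 < 2)%N))).
    by rewrite leq_exp2l// ltnS leq_addl.
  case: (ex_minnP ex) => k kP kmin; exists k => //; split => //.
  case: k kP kmin => [|k] kP kmin; first by rewrite addn0.
  rewrite leNgt; apply/negP => lt; have := kmin k.
  by rewrite -addnS lt => /(_ isT); rewrite ltnn.
have PA k : (P (A k) <= (2 * C / kap / 2 ^+ m / (2 ^ k.+1)%:R)%:E)%E.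
  rewrite -[X in (X <= _)%E]fineK ?fin_num_measure// lee_fin -mean_indic//.
  pose v : R := (2 ^+ (m + k))^-1.
  have v01 : 0 < v <= 1 by rewrite invr_gt0 exprn_gt0//= invf_le1 ?exprn_gt0// exprn_ege1// ler1n.
  have bc : bmfun (fun w => 1 - cos (v * x w)).
    apply: bmfunB; first exact: bmfun_cst.
    by apply: bmfun_cos; exact: measurable_funM.
  apply: (@le_trans _ _ (\int[P]_w (kap^-1 * (1 - cos (v * x w))))).
    apply: le_mean; [exact: bmfun_indic|exact: bmfunZ|move=> w].
    rewrite indicE; case: (boolP (w \in A k)) => [|_]; last first.
      by rewrite mulr_ge0 ?invr_ge0 ?(ltW kap0)// subr_ge0 cos_le1.
    rewrite inE => -[lo hi]; rewrite mulrC ler_pdivlMr// mul1r.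
    have hv : 1 <= `|v * x w| < 2.
      case/andP: v01 => v0 _; rewrite normrM (gtr0_norm v0) /v mulrC.
      by rewrite ler_pdivlMr ?exprn_gt0// ltr_pdivrMr ?exprn_gt0// mul1r lo -exprS.
    case/andP: hv => h1 h2; rewrite lerD2l lerN2 -[cos (v * _)]cos_norm.
    move: h1; rewrite le_eqVlt => /predU1P[<-//|h1].
    by apply: ltW; rewrite ltr_cos// in_itv/=; apply/andP; split; lra.
  rewrite meanZ// mulrC ler_pdivrMr//; apply: (le_trans (xC _ v01)).
  rewrite /v le_eqVlt; apply/orP; left; apply/eqP.
  rewrite natrX exprS exprD; field.
  by rewrite !expf_neq0//= gt_eqF.
have C0 : 0 <= C.
  have h : 0 < (1 : R) <= 1 by rewrite ltr01 lexx.
  have := xC 1 h; rewrite mulr1; apply: le_trans.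
  by apply: Rintegral_ge0 => w _; rewrite subr_ge0 cos_le1.
apply: (le_trans (measure_sigma_subadditive P mA mS SA)).
apply: le_trans (epsilon_trick0 xpredT _).
  by apply: lee_nneseries => [k _ _|k _]; [exact: measure_ge0|exact: PA].
by rewrite divr_ge0 ?exprn_ge0// divr_ge0 ?(ltW kap0)// mulr_ge0.
Qed.

End tail.

(** * A continuity theorem for characteristic functions *)

Section test_functions.
Context d (T : measurableType d) (R : realType) (P : probability T R).
Context {dim : nat}.
Variable X : T -> 'rV[R]_dim.
Hypothesis mX : forall theta : 'rV[R]_dim, measurable_fun setT (fun w => inner theta (X w)).

Lemma bmfun_sum (I : Type) (r : seq I) (F : I -> T -> R) :
  (forall i, bmfun (F i)) -> bmfun (fun w => \sum_(i <- r) F i w).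
Proof.
move=> bF; elim: r => [|i r IH].
  by under eq_fun do rewrite big_nil; exact: bmfun_cst.
by under eq_fun do rewrite big_cons; exact: bmfunD.
Qed.

Lemma mean_sum (I : Type) (r : seq I) (F : I -> T -> R) : (forall i, bmfun (F i)) ->
  \int[P]_w (\sum_(i <- r) F i w) = \sum_(i <- r) \int[P]_w F i w.
Proof.
move=> bF; elim: r => [|i r IH].
  by under eq_Rintegral do rewrite big_nil; rewrite big_nil (mean_cst P).
under eq_Rintegral do rewrite big_cons.
by rewrite big_cons -IH meanD//; exact: bmfun_sum.
Qed.

Lemma bmfun_trigpoly (g : 'rV[R]_dim -> R) : trigpoly g -> bmfun (fun w => g (X w)).
Proof.
elim=> [theta b|f1 f2 _ IH1 _ IH2|c f1 _ IH].
- by apply: bmfun_cos; exact: measurable_funD.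
- exact: bmfunD.
- exact: bmfunZ.
Qed.

(** Only the linear forms of [X] are assumed measurable.  A continuous function of [X] is a
    pointwise limit of trigonometric polynomials of [X], one for each box [|y| <= k]. *)
Lemma bmfun_continuous (f : 'rV[R]_dim -> R) (B : R) : continuous f ->
  (forall x, `|f x| <= B) -> bmfun (fun w => f (X w)).
Proof.
move=> cf fB; split; last by exists B => w; exact: fB.
have : forall k : nat, exists g, [/\ trigpoly g, forall y, `|g y| <= B &
    forall y : 'rV[R]_dim, (forall i, `|y 0 i| <= k%:R) -> `|g y - f y| <= k.+1%:R^-1].
  by move=> k; apply: trig_approx.
move=> /choice[g gP].
apply: (@measurable_fun_cvg _ _ _ _ (fun k w => g k (X w))).
  by move=> k; have [tg _ _] := gP k; have [] := bmfun_trigpoly tg.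
move=> w _; apply/cvgrPdist_le => e e0; near=> k.
have [_ _ H] := gP k.
rewrite distrC (le_trans (H (X w) _))//.
  move=> i; apply: (@le_trans _ _ `|X w|).
    rewrite [leRHS]/Num.Def.normr/= mx_normrE.
    by apply/bigmax_geP; right; exists (0, i).
  by near: k; exact: nbhs_infty_ger.
rewrite -[leRHS]invrK lef_pV2 ?posrE ?invr_gt0//.
apply: (@le_trans _ _ k%:R); last by rewrite ler_nat.
by near: k; exact: nbhs_infty_ger.
Unshelve. all: end_near. Qed.

(** Inside the box the two functions differ by at most [e]; outside they differ by at most
    [2 B], and the probability of the outside is controlled coordinate by coordinate. *)
Lemma mean_approx (f g : 'rV[R]_dim -> R) (B e C : R) (m : nat) :
  continuous f -> (forall x, `|f x| <= B) -> trigpoly g -> (forall x, `|g x| <= B) ->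
  (forall y : 'rV[R]_dim, (forall i, `|y 0 i| <= 2 ^+ m) -> `|g y - f y| <= e) ->
  0 <= e ->
  (forall i v, 0 < v <= 1 -> \int[P]_w (1 - cos (v * X w 0 i)) <= C * v) ->
  `|\int[P]_w g (X w) - \int[P]_w f (X w)| <=
    e + 2 * B * (dim%:R * (2 * C / (1 - cos 1) / 2 ^+ m)).
Proof.
move=> cf fB tg gB gf e0 HC.
have B0 : 0 <= B := le_trans (normr_ge0 _) (fB 0).
have mXi i : measurable_fun setT (fun w => X w 0 i).
  by have := mX (delta_mx 0 i); under eq_fun do rewrite inner_delta.
pose A i := [set w | 2 ^+ m <= `|X w 0 i|].
have mA i : measurable (A i).
  rewrite [A i](_ : _ = setT `&` (fun w => `|X w 0 i|) @^-1` `[2 ^+ m, +oo[).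
    exact: (measurableT_comp _ (mXi i)).
  by rewrite setTI; apply/seteqP; split => w /=; rewrite in_itv/= andbT.
have bf := bmfun_continuous cf fB; have bg := bmfun_trigpoly tg.
rewrite -meanB//; apply: (le_trans (ler_norm_mean _ (bmfunB bg bf))).
have bs : bmfun (fun w => \sum_i (\1_(A i) w : R)).
  by apply: bmfun_sum => i; exact: bmfun_indic.
apply: (@le_trans _ _ (\int[P]_w (e + 2 * B * \sum_i (\1_(A i) w : R)))).
  apply: le_mean.
  - by apply: bmfun_norm; exact: bmfunB.
  - by apply: bmfunD; [exact: bmfun_cst|exact: bmfunZ].
  move=> w; have s0 : 0 <= \sum_i (\1_(A i) w : R) by apply: sumr_ge0.
  have [small|] := pselect (forall i, `|X w 0 i| <= 2 ^+ m).
    by rewrite (le_trans (gf _ small))// lerDl mulr_ge0// mulr_ge0.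
  move=> /existsNP[i /negP]; rewrite -ltNge => /ltW big.
  apply: (@le_trans _ _ (2 * B)).
    rewrite (le_trans (ler_normB _ _))//.
    by have := fB (X w); have := gB (X w); move=> *; lra.
  apply: (@le_trans _ _ (2 * B * \sum_i (\1_(A i) w : R))); last by rewrite lerDr.
  rewrite -[leLHS]mulr1 ler_wpM2l ?mulr_ge0// (bigD1 i)//= indicE mem_set//.
  by rewrite lerDl sumr_ge0.
rewrite (meanD P (bmfun_cst _ e)); last exact: bmfunZ.
rewrite (mean_cst P) lerD2l meanZ// ler_wpM2l ?mulr_ge0//.
rewrite mean_sum; last by move=> i; exact: bmfun_indic.
rewrite -[dim in dim%:R]card_ord mulr_natl -sumr_const; apply: ler_sum => i _.
rewrite mean_indic// -lee_fin fineK ?fin_num_measure//.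
exact: (tail_bound m (mXi i) (HC i)).
Qed.

End test_functions.

Section levy.
Context d (T : measurableType d) d' (T' : measurableType d') (R : realType).
Variables (P : probability T R) (Q : probability T' R) (dim : nat).
Variables (X : nat -> T -> 'rV[R]_dim) (Z : T' -> 'rV[R]_dim) (C : R).
Hypothesis mX : forall n (theta : 'rV[R]_dim), measurable_fun setT (fun w => inner theta (X n w)).
Hypothesis mZ : forall theta : 'rV[R]_dim, measurable_fun setT (fun w => inner theta (Z w)).
Hypothesis tX : \forall n \near \oo, forall i v, 0 < v <= 1 ->
  \int[P]_w (1 - cos (v * X n w 0 i)) <= C * v.
Hypothesis tZ : forall i v, 0 < v <= 1 ->
  \int[Q]_w (1 - cos (v * Z w 0 i)) <= C * v.
Hypothesis cvX : forall theta b, \int[P]_w cos (inner theta (X n w) + b) @[n --> \oo] -->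
  \int[Q]_w cos (inner theta (Z w) + b).

Lemma cvg_trigpoly (g : 'rV[R]_dim -> R) : trigpoly g ->
  \int[P]_w g (X n w) @[n --> \oo] --> \int[Q]_w g (Z w).
Proof.
elim=> [theta b|f1 f2 t1 IH1 t2 IH2|c f1 t1 IH]; first exact: cvX.
- rewrite (meanD Q (bmfun_trigpoly mZ t1) (bmfun_trigpoly mZ t2)).
  under eq_cvg do rewrite (meanD P (bmfun_trigpoly (mX _) t1) (bmfun_trigpoly (mX _) t2)).
  exact: cvgD.
- rewrite (meanZ Q c (bmfun_trigpoly mZ t1)).
  under eq_cvg do rewrite (meanZ P c (bmfun_trigpoly (mX _) t1)).
  exact: cvgMr.
Qed.

(** The linear tail hypotheses replace tightness: with them it suffices to test against
    trigonometric polynomials. *)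
Theorem levy_continuity : cvg_in_distribution P X Q Z.
Proof.
move=> f cf [M [_ HM]].
have {M HM} [B fB] : exists B : R, forall x, `|f x| <= B.
  by exists (M + 1) => x; apply: HM => //; rewrite ltrDl.
have B0 : 0 <= B := le_trans (normr_ge0 _) (fB 0).
rewrite -(EFin_mean Q (bmfun_continuous mZ cf fB)).
under eq_cvg do rewrite -(EFin_mean P (bmfun_continuous (mX _) cf fB)).
apply: cvg_EFin; first exact: nearW.
apply/cvgrPdist_le => e e0.
pose kap : R := 1 - cos 1.
pose K := 2 * B * (dim%:R * (2 * C / kap)).
have e6 : 0 < e / 6 by rewrite divr_gt0.
have [m Km] : exists m, K / 2 ^+ m <= e / 6.
  exists (Num.truncn (K / (e / 6))).
  rewrite ler_pdivrMr ?exprn_gt0// mulrC -ler_pdivrMr//.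
  apply: (le_trans (ltW (truncnS_gt _))).
  by rewrite -natrX ler_nat ltn_expl.
have [g [tg gB gf]] := trig_approx (2 ^+ m) cf fB e6.
have near_g : \forall n \near \oo, `|\int[Q]_w g (Z w) - \int[P]_w g (X n w)| <= e / 3.
  by have /cvgrPdist_le := cvg_trigpoly tg; apply; rewrite divr_gt0.
have KE : 2 * B * (dim%:R * (2 * C / kap / 2 ^+ m)) = K / 2 ^+ m.
  by rewrite /K; ring.
near=> n.
have h1 : `|\int[Q]_w g (Z w) - \int[P]_w g (X n w)| <= e / 3 by near: n.
have h2 := mean_approx mZ cf fB tg gB gf (ltW e6) tZ.
have tn : forall i v, 0 < v <= 1 -> \int[P]_w (1 - cos (v * X n w 0 i)) <= C * v by near: n.
have h3 := mean_approx (mX n) cf fB tg gB gf (ltW e6) tn.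
rewrite -/kap KE in h2 h3.
move: h1 h2 h3; set a := \int[Q]_w _; set b := \int[P]_w _.
set a' := \int[Q]_w _; set b' := \int[P]_w _.
move=> h1 h2 h3.
rewrite (_ : a' - b' = (a - b) + ((b - b') - (a - a'))); last by ring.
apply: (le_trans (ler_normD _ _)).
apply: (@le_trans _ _ (e / 3 + (`|b - b'| + `|a - a'|))).
  by rewrite lerD// ler_normB.
by lra.
Unshelve. all: end_near. Qed.

End levy.

(** * The Gamma function and its increments *)

Section gamma.
Context {R : realType}.
Implicit Types (x s u : R).
Notation mu := (@lebesgue_measure R).

(** Half of the exponential decay absorbs the power. *)
Lemma powR_expR_bound (r : R) : 0 <= r -> exists2 K : R, 0 < K &
  forall u, 0 <= u -> u `^ r * expR (- u) <= K * (2^-1 * expR (- 2^-1 * u)).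
Proof.
move=> r0; pose n := Num.truncn r.
have rn : r <= n.+1%:R by rewrite ltW// truncnS_gt.
exists (2 * (2 ^+ n.+1 * n.+1`!%:R * expR 2^-1)) => [|u u0].
  by rewrite !mulr_gt0 ?expR_gt0 ?exprn_gt0// ltr0n fact_gt0.
have -> : expR (- u) = expR (- 2^-1 * u) * expR (- 2^-1 * u).
  by rewrite -expRD; congr expR; lra.
rewrite -mulrA [leRHS](_ : _ = (2 ^+ n.+1 * n.+1`!%:R * expR 2^-1) *
  expR (- 2^-1 * u)); last by field.
rewrite mulrA ler_pM2r ?expR_gt0// -ler_pdivlMr ?expR_gt0//.
rewrite -expRN mulNr opprK -[leRHS]mulrA -expRD.
have up : 0 <= 1 + u by lra.
apply: (@le_trans _ _ ((1 + u) `^ r)).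
  by apply: ge0_ler_powR => //; rewrite ?nnegrE//; lra.
apply: (@le_trans _ _ ((1 + u) `^ n.+1%:R)); first by apply: ler_powR => //; lra.
rewrite powR_mulrn//.
have /(expR_ge1Dxn n) : 0 <= 2^-1 * (1 + u) by rewrite mulr_ge0//.
rewrite (_ : 2^-1 * (1 + u) = 2^-1 + 2^-1 * u); last by lra.
move=> H; have {H} : (2^-1 + 2^-1 * u) ^+ n.+1 / n.+1`!%:R <= expR (2^-1 + 2^-1 * u) by lra.
rewrite ler_pdivrMr ?ltr0n ?fact_gt0// => H.
rewrite [leLHS](_ : _ = 2 ^+ n.+1 * (2^-1 + 2^-1 * u) ^+ n.+1); last first.
  by rewrite -exprMn; congr (_ ^+ _); field.
rewrite -[leRHS]mulrA ler_pM2l ?exprn_gt0//. by rewrite [leRHS]mulrC.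
Qed.

Lemma powR_cvg_at_right0 (r : R) : 0 <= r -> u `^ r @[u --> 0^'+] --> 0 `^ r.
Proof.
rewrite le_eqVlt => /predU1P[<-|r0]; last by rewrite powR0 ?gt_eqF//; exact: powR_cvg0.
by under eq_fun do rewrite powRr0; rewrite powRr0; exact: cvg_cst.
Qed.

Lemma within_continuous_powR (r : R) : 0 <= r ->
  {within `[0, +oo[, continuous (fun u : R => u `^ r)}.
Proof.
move=> r0; apply/continuous_within_itvcyP; split; last exact: powR_cvg_at_right0.
move=> u u0; apply: differentiable_continuous; apply/derivable1_diffP.
exact: derivable_powR.
Qed.

Lemma continuous_expRMl (a : R) : continuous (fun u : R => expR (a * u)).
Proof.
move=> u; apply: continuous_comp; last exact: continuous_expR.
by apply: continuousM; [exact: cst_continuous|exact: id].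
Qed.

Lemma integrable_half_exp :
  mu.-integrable `[0, +oo[ (EFin \o (fun u => 2^-1 * expR (- 2^-1 * u))).
Proof.
have h : (0 : R) < 2^-1 by [].
have : mu.-integrable `[0, +oo[ (EFin \o exponential_pdf (2^-1 : R)).
  by apply: integrableS (integrable_exponential_pdf h).
apply: eq_integrable => // u; rewrite inE/= in_itv/= andbT => u0.
by rewrite exponential_pdfE.
Qed.

Lemma measurable_powR_expR (r : R) (D : set R) :
  measurable_fun D (fun u => u `^ r * expR (- u)).
Proof.
apply: measurable_funTS; apply: measurable_funM; first exact: measurable_powR.
by apply: measurableT_comp => //; exact: measurable_funN.
Qed.

Lemma integrable_powR_expR (r : R) : 0 <= r ->
  mu.-integrable `[0, +oo[ (EFin \o (fun u => u `^ r * expR (- u))).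
Proof.
move=> r0; have [K K0 HK] := powR_expR_bound r0.
have : mu.-integrable `[0, +oo[
    (EFin \o (fun u => K * (2^-1 * expR (- 2^-1 * u)))).
  exact: integrableZl integrable_half_exp.
apply: le_integrable => //; first by apply/measurable_EFinP; exact: measurable_powR_expR.
move=> u/=; rewrite in_itv/= andbT => u0; rewrite lee_fin.
rewrite ger0_norm ?mulr_ge0 ?powR_ge0 ?expR_ge0//.
by rewrite ger0_norm ?HK// !mulr_ge0 ?expR_ge0// ltW.
Qed.

Lemma GammaE x : 1 <= x ->
  Gamma x = \int[mu]_(u in `[0, +oo[) (u `^ (x - 1) * expR (- u)).
Proof.
move=> x1; rewrite /Gamma Rintegral_itv_obnd_cbnd//.
have : mu.-integrable `[0, +oo[ (EFin \o (fun u => u `^ (x - 1) * expR (- u))).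
  by apply: integrable_powR_expR; rewrite subr_ge0.
by apply: integrableS => // u /=; rewrite !in_itv/= !andbT; exact: ltW.
Qed.

Lemma expRMl_cvg0 (a : R) : 0 < a -> expR (- a * u) @[u --> +oo] --> 0.
Proof.
move=> a0; rewrite (_ : (fun u => expR (- a * u)) =
               (fun z => expR (- z)) \o (fun z => a * z)); last first.
  by apply: eq_fun => u; rewrite mulNr.
apply: (@cvg_comp _ _ _ _ _ _ (pinfty_nbhs R)); last exact: cvgr_expR.
exact: gt0_cvgMry.
Qed.

Lemma powR_expR_cvg0 (r : R) : 0 <= r -> u `^ r * expR (- u) @[u --> +oo] --> 0.
Proof.
move=> r0; have [K K0 HK] := powR_expR_bound r0.
apply: (@squeeze_cvgr _ _ _ _ (cst 0) (fun u => K * (2^-1 * expR (- 2^-1 * u)))).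
- near=> u; have u0 : 0 <= u by near: u; exact: nbhs_pinfty_ge.
  by rewrite HK// mulr_ge0 ?powR_ge0 ?expR_ge0.
- exact: cvg_cst.
- rewrite (_ : 0 = K * (2^-1 * 0)); last by rewrite !mulr0.
  by apply: cvgMr; apply: cvgMr; exact: expRMl_cvg0.
Unshelve. all: end_near. Qed.


(** The derivative of [- u^x exp (- u)] changes sign at [u = x].  Adding a large multiple of
    [exp (- u / 2)] to the integrand makes it nonnegative, which is what the fundamental theorem
    of calculus on a half-line requires. *)
Lemma Gamma_add1 x : 1 <= x -> Gamma (x + 1) = x * Gamma x.
Proof.
move=> x1; have x0 : 0 < x by lra.
have x10 : 0 <= x - 1 by lra.
have [K K0 HK] := powR_expR_bound x10.
pose h u : R := 2^-1 * expR (- 2^-1 * u).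
(* the last term makes the integrand nonnegative, and K bounds the middle one *)
pose f u : R := u `^ x * expR (- u) + (- x) * (u `^ (x - 1) * expR (- u)) + (x * K) * h u.
pose F u : R := - (u `^ x * expR (- u) + (x * K) * expR (- 2^-1 * u)).
have iA : mu.-integrable `[0, +oo[ (EFin \o (fun u => u `^ x * expR (- u))).
  by apply: integrable_powR_expR; exact: ltW.
have iB : mu.-integrable `[0, +oo[ (EFin \o (fun u => u `^ (x - 1) * expR (- u))).
  exact: integrable_powR_expR.
have iB' : mu.-integrable `[0, +oo[ (EFin \o (fun u => - x * (u `^ (x - 1) * expR (- u)))).
  exact: integrableZl iB.
have iC := integrable_half_exp.
have iC' : mu.-integrable `[0, +oo[ (EFin \o (fun u => (x * K) * h u)).
  exact: integrableZl iC.
have ch : continuous h.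
  by move=> u; apply: cvgMr; exact: continuous_expRMl.
have cN : continuous (fun u : R => expR (- u)).
  by move=> u; under eq_fun do rewrite -mulN1r; exact: continuous_expRMl.
have Ih : \int[mu]_(u in `[0, +oo[) h u = 1.
  rewrite (@Rintegral_ge0_continuous_FTC2y _ h (fun u => - expR (- 2^-1 * u)) 0 0).
  - by rewrite mulr0 expR0; lra.
  - by move=> u _; rewrite mulr_ge0 ?expR_ge0.
  - exact: continuous_subspaceT.
  - by rewrite -oppr0; apply: cvgN; exact: expRMl_cvg0.
  - by [].
  - by apply: cvgN; apply/cvg_at_right_filter; exact: continuous_expRMl.
  - move=> u _; rewrite derive1E derive_val /h /GRing.scale/=; lra.
have dF u : 0 < u -> is_derive u 1 F (f u).
  move=> u0; have dp := is_derive1_powR x u0.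
  have de (a : R) : is_derive u 1 (fun u => expR (a * u)) (a * expR (a * u)).
    by apply: is_derive_eq; rewrite /GRing.scale/=; lra.
  have de1 : is_derive u 1 (fun u => expR (- u)) (- expR (- u)).
    have := de (-1); rewrite !mulN1r; congr is_derive.
    by apply/funext => v; rewrite mulN1r.
  have d1 : is_derive u 1 (fun u => u `^ x * expR (- u))
     (u `^ x * (- expR (- u)) + expR (- u) * (x * u `^ (x - 1))).
    by apply: (is_derive_eq (is_deriveM dp de1)); rewrite /GRing.scale/=.
  have d2 : is_derive u 1 (fun u => (x * K) * expR (- 2^-1 * u))
     ((x * K) * (- 2^-1 * expR (- 2^-1 * u))).
    by apply: (is_derive_eq (is_deriveZ (x * K) (de (- 2^-1)))); rewrite /GRing.scale/=.
  rewrite (_ : f u = - ((u `^ x * (- expR (- u)) + expR (- u) * (x * u `^ (x - 1)))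
      + (x * K) * (- 2^-1 * expR (- 2^-1 * u)))); last by rewrite /f /h; ring.
  exact: is_deriveN (is_deriveD d1 d2).
have If : \int[mu]_(u in `[0, +oo[) f u = x * K.
  rewrite (@Rintegral_ge0_continuous_FTC2y _ f F 0 0).
  - by rewrite /F mulr0 expR0 powR0 ?gt_eqF//; lra.
  - move=> u u0; rewrite /f /h -addrA addr_ge0 ?mulr_ge0 ?powR_ge0 ?expR_ge0//.
    by rewrite mulNr addrC subr_ge0 -mulrA ler_pM2l// HK.
  - have cp (r : R) : 0 <= r ->
        {within `[0, +oo[, continuous (fun u : R => u `^ r * expR (- u))}.
      move=> r0; apply/subspace_continuousP => u u0; apply: cvgM.
        by have /subspace_continuousP := within_continuous_powR r0; exact.
      by apply: cvg_within_filter; exact: cN.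
    apply/subspace_continuousP => u u0; apply: cvgD.
      apply: cvgD; first by have /subspace_continuousP := cp x (ltW x0); exact.
      by apply: cvgMr; have /subspace_continuousP := cp (x - 1) x10; exact.
    by apply: cvgMr; apply: cvg_within_filter; exact: ch.
  - rewrite /F -oppr0 (_ : 0 = 0 + (x * K) * 0 :> R); last by rewrite mulr0 addr0.
    apply: cvgN; apply: cvgD; first by apply: powR_expR_cvg0; exact: ltW.
    by apply: cvgMr; exact: expRMl_cvg0.
  - by move=> u /dF[].
  - rewrite /F; apply: cvgN; apply: cvgD.
      apply: cvgM; first by apply: powR_cvg_at_right0; exact: ltW.
      by apply/cvg_at_right_filter; exact: cN.
    by apply: cvgMr; apply/cvg_at_right_filter; exact: continuous_expRMl.
  - move=> u; rewrite in_itv/= andbT => u0.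
    by rewrite derive1E; have [_ ->] := dF _ u0.
move: If; rewrite /f RintegralD//; last by rewrite /=; exact: (integrableD _ iA iB').
rewrite RintegralD// (@RintegralZl _ _ _ mu _ h)// RintegralZl// Ih mulr1.
move=> /(canRL (addrK _)); rewrite subrr.
rewrite -GammaE// => H.
rewrite GammaE ?ler_wpDl ?(ltW x0)//.
rewrite addrK; apply/eqP; rewrite -subr_eq0 -mulNr; exact/eqP.
Qed.


Lemma Gamma1 : Gamma 1 = 1 :> R.
Proof.
rewrite GammaE// subrr.
rewrite (@Rintegral_ge0_continuous_FTC2y _ _ (fun u => - expR (- 1 * u)) 0 0).
- by rewrite mulr0 expR0; lra.
- by move=> u _; rewrite mulr_ge0 ?powR_ge0 ?expR_ge0.
- rewrite (_ : (fun u : R => u `^ 0 * expR (- u)) = (fun u => expR (- 1 * u))).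
    by apply: continuous_subspaceT; exact: continuous_expRMl.
  by apply/funext => u; rewrite powRr0 mul1r mulN1r.
- by rewrite -oppr0; apply: cvgN; exact: expRMl_cvg0.
- by [].
- by apply: cvgN; apply/cvg_at_right_filter; exact: continuous_expRMl.
- by move=> u _; rewrite derive1E derive_val /GRing.scale/= powRr0 !mulN1r; lra.
Qed.

Lemma Gamma_natS n : Gamma n.+1%:R = n`!%:R :> R.
Proof.
elim: n => [|n IH]; first by rewrite Gamma1 fact0.
by rewrite -natr1 Gamma_add1 ?ler1n// IH -natrM factS.
Qed.

Lemma Gamma_ge0 x : 0 <= Gamma x.
Proof. by apply: Rintegral_ge0 => u _; rewrite mulr_ge0 ?powR_ge0 ?expR_ge0. Qed.

(** The tangent to the concave function [v^s] at [v = 1]. *)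
Lemma powR_le_tangent (v s : R) : 0 <= v -> 0 <= s <= 1 -> v `^ s <= 1 - s + s * v.
Proof.
move=> v0 /andP[s0 s1]; have [->|vn0] := eqVneq v 0.
  have [->|sn0] := eqVneq s 0; first by rewrite powRr0; lra.
  by rewrite powR0//; lra.
rewrite /powR (negbTE vn0); set l := ln v.
have -> : v = expR l by rewrite lnK// posrE lt_neqAle eq_sym vn0.
have h1 : expR (s * l) * (1 + (1 - s) * l) <= expR l.
  rewrite [leRHS](_ : _ = expR (s * l) * expR ((1 - s) * l)); last first.
    by rewrite -expRD; congr expR; ring.
  by rewrite ler_pM2l ?expR_gt0// expR_ge1Dx.
have h2 : expR (s * l) * (1 - s * l) <= 1.
  rewrite [leRHS](_ : _ = expR (s * l) * expR (- (s * l))); last first.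
    by rewrite -expRD subrr expR0.
  by rewrite ler_pM2l ?expR_gt0// expR_ge1Dx.
have h1' := ler_wpM2l s0 h1.
have s1' : 0 <= 1 - s by lra.
have h2' := ler_wpM2l s1' h2.
nra.
Qed.

Lemma integrable_Gamma x : 1 <= x ->
  mu.-integrable `]0, +oo[ (EFin \o (fun u => u `^ (x - 1) * expR (- u))).
Proof.
move=> x1.
have : mu.-integrable `[0, +oo[ (EFin \o (fun u => u `^ (x - 1) * expR (- u))).
  by apply: integrable_powR_expR; rewrite subr_ge0.
by apply: integrableS => // u /=; rewrite !in_itv/= !andbT; exact: ltW.
Qed.

(** Integrate the tangent inequality for [(u / x)^s]; the right-hand side collapses because
    [Gamma (x + 1) = x Gamma x]. *)
Lemma Gamma_addr_le x s : 1 <= x -> 0 <= s <= 1 ->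
  Gamma (x + s) <= x `^ s * Gamma x.
Proof.
move=> x1 /andP[s0 s1]; have x0 : 0 < x by lra.
have [i0 i1] : 1 <= x + s /\ 1 <= x + 1 by split; lra.
have I1 := integrable_Gamma i0.
have I2 := integrable_Gamma x1.
have I3 := integrable_Gamma i1.
have I2' : mu.-integrable `]0, +oo[ (EFin \o
    (fun u => (1 - s) * (u `^ (x - 1) * expR (- u)))) by exact: integrableZl I2.
have I3' : mu.-integrable `]0, +oo[ (EFin \o
    (fun u => s / x * (u `^ (x + 1 - 1) * expR (- u)))) by exact: integrableZl I3.
have I4 : mu.-integrable `]0, +oo[ (EFin \o (fun u =>
  (1 - s) * (u `^ (x - 1) * expR (- u)) +
  s / x * (u `^ (x + 1 - 1) * expR (- u)))).
  by rewrite /=; exact: (integrableD _ I2' I3').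
have -> : x `^ s * Gamma x = \int[mu]_(u in `]0, +oo[) (x `^ s *
    ((1 - s) * (u `^ (x - 1) * expR (- u)) +
     s / x * (u `^ (x + 1 - 1) * expR (- u)))).
  rewrite RintegralZl// RintegralD// !RintegralZl// -!/(Gamma _) Gamma_add1//.
  by field; rewrite gt_eqF.
apply: le_Rintegral => //; first exact: integrableZl I4.
move=> u /=; rewrite in_itv/= andbT => u0.
have un0 : u != 0 by rewrite gt_eqF.
rewrite addrK (_ : x + s - 1 = (x - 1) + s); last by ring.
rewrite [u `^ (x - 1 + s)]powRD; last by rewrite un0 implybT.
rewrite -(@mulr_powRB1 _ u x (ltW u0) x0).
rewrite (_ : u `^ s = x `^ s * (u / x) `^ s); last first.
  by rewrite -powRM ?divr_ge0 ?(ltW u0) ?(ltW x0)// mulrCA divff ?mulr1// gt_eqF.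
have ux : 0 <= u / x by rewrite divr_ge0// ltW.
have T := powR_le_tangent ux (introT andP (conj s0 s1)).
rewrite [leLHS](_ : _ = x `^ s * ((u `^ (x - 1) * expR (- u)) * (u / x) `^ s));
  last by ring.
rewrite ler_wpM2l ?powR_ge0//.
rewrite [leRHS](_ : _ = (u `^ (x - 1) * expR (- u)) * (1 - s + s * (u / x)));
  last by field; rewrite gt_eqF.
by rewrite ler_wpM2l// mulr_ge0 ?powR_ge0 ?expR_ge0.
Qed.

End gamma.

Section asc.
Context {R : realType}.
Implicit Types (b : R) (c : nat).

(** This is [Gamma (b + c) / (Gamma c Gamma (b + 1))] for [c >= 1], and 0 at [c = 0], so that
    clusters not yet born contribute nothing. *)
Definition asc b c : R :=
  if c is c'.+1 then \prod_(k < c') (1 + b / k.+1%:R) else 0.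

Lemma asc0 b : asc b 0 = 0. Proof. by []. Qed.

Lemma asc1 b : asc b 1 = 1. Proof. by rewrite /asc big_ord0. Qed.

Lemma asc_ge0 b c : 0 <= b -> 0 <= asc b c.
Proof.
move=> b0; case: c => // c; apply: prodr_ge0 => k _.
by rewrite addr_ge0// divr_ge0.
Qed.

(** The reason for using [asc] instead of a power: its increment is proportional to itself
    over [c], and [c] is the factor by which a cluster of size [c] is favoured. *)
Lemma ascS b c : c%:R * (asc b c.+1 - asc b c) = b * asc b c.
Proof.
case: c => [|c]; first by rewrite mul0r asc0 mulr0.
rewrite {1}/asc big_ord_recr/= -/(asc b c.+1).
by field; rewrite ?natr1 ?nat1r pnatr_eq0.
Qed.

Lemma Gamma_asc b c : 0 <= b ->
  Gamma (b + 1) * asc b c.+1 * c`!%:R = Gamma (b + c.+1%:R).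
Proof.
move=> b0; elim: c => [|c IH]; first by rewrite asc1 fact0 !mulr1.
rewrite -[c.+2%:R]natr1 addrA (@Gamma_add1 _ (b + _)); last first.
  by rewrite -natr1 addrA lerDr addr_ge0.
rewrite -IH factS natrM /asc [in LHS]big_ord_recr/=.
by field; rewrite ?natr1 ?nat1r pnatr_eq0.
Qed.

(** With [a = 1 + s], both Gamma inequalities are instances of [Gamma_addr_le]: from [c + 1] by
    [s], and from [c + a] by [1 - s].  They give
      (c + a)^(s - 1) (c + 1) <= G asc / c <= (c + 1)^s,   G = Gamma (a + 1),
    and both ends are within 1 of [c^s]. *)
Lemma powR_asc_le (a : R) c : 1 <= a <= 2 ->
  `|c%:R `^ a - Gamma (a + 1) * asc a c| <= c%:R.
Proof.
move=> /andP[a1 a2]; case: c => [|c].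
  by rewrite asc0 mulr0 subr0 powR0 ?normr0 ?gt_eqF//; lra.
set g := Gamma _ * _; pose s := a - 1; pose n : R := c.+1%:R.
have n1 : 1 <= n by rewrite ler1n.
have [s0 s1 n0] : [/\ 0 <= s, s <= 1 & 0 < n] by rewrite /s; split; lra.
have [a0 n1' an1 n11] : [/\ 0 <= a, 1 <= n + 1, 1 <= a + n & 1 <= n + 1 + 1].
  by split; lra.
have pa : n `^ a = n * n `^ s by rewrite /s mulr_powRB1//; lra.
have [up lo] : g <= n * (n + 1) `^ s /\ n * (n + 1) <= g * (n + a) `^ (1 - s).
  have f0 : 0 < c`!%:R :> R by rewrite ltr0n fact_gt0.
  have GE : Gamma (a + n) = g * c`!%:R by rewrite /g -Gamma_asc.
  have Gn1 : Gamma (n + 1) = n * c`!%:R by rewrite natr1 Gamma_natS factS natrM.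
  clearbody g; split.
    have := @Gamma_addr_le _ (n + 1) s n1'; rewrite s0 s1 => /(_ isT).
    rewrite (_ : n + 1 + s = a + n); last by rewrite /s; ring.
    by rewrite GE Gn1 mulrA ler_pM2r// mulrC.
  have := @Gamma_addr_le _ (a + n) (1 - s) an1.
  rewrite subr_ge0 s1 gerBl s0 => /(_ isT).
  rewrite (_ : a + n + (1 - s) = n + 1 + 1); last by rewrite /s; ring.
  rewrite (Gamma_add1 n1') GE Gn1 !mulrA ler_pM2r//.
  by rewrite (addrC a n) (mulrC _ g) (mulrC n).
change (`|n `^ a - g| <= n); clearbody g n.
have bup : (n + 1) `^ s <= n `^ s + 1.
  rewrite (_ : n + 1 = n * (1 + n^-1)); last by field; rewrite gt_eqF.
  have v0 : 0 <= 1 + n^-1 by rewrite addr_ge0// invr_ge0 ltW.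
  rewrite powRM ?(ltW n0)//.
  have := powR_le_tangent v0 (introT andP (conj s0 s1)).
  move=> /(ler_wpM2l (powR_ge0 n s)) /le_trans; apply.
  rewrite [leLHS](_ : _ = n `^ s + s * (n `^ s / n)); last by ring.
  rewrite lerD2l mulr_ile1// ?divr_ge0 ?powR_ge0// ?(ltW n0)//.
  by rewrite ler_pdivrMr// mul1r ler1_powR.
have blo : n `^ s - 1 <= (n + 1) / (n + a) `^ (1 - s).
  have A0 : 1 <= n + a by lra.
  have s1' : 0 <= 1 - s by lra.
  (* (n + 1) (n + a)^(s - 1) equals (n + a)^s - s (n + a)^(s - 1) *)
  have AE : (n + a) `^ s * (n + a) `^ (1 - s) = n + a.
    rewrite -powRD; last by apply/implyP => _; rewrite gt_eqF//; lra.
    by rewrite (_ : s + (1 - s) = 1) ?powRr1//; lra.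
  have A1 : 1 <= (n + a) `^ (1 - s).
    by rewrite -[leLHS](powRr0 (n + a)) ler_powR.
  rewrite ler_pdivlMr; last by lra.
  have -> : n + 1 = (n + a) - s by rewrite /s; ring.
  rewrite mulrBl mul1r lerB//; last exact: le_trans A1.
  rewrite -[leRHS]AE ler_wpM2r ?powR_ge0// ge0_ler_powR// ?nnegrE; lra.
rewrite pa ler_norml; apply/andP; split.
  have := ler_wpM2l (ltW n0) bup; lra.
rewrite lerBlDr -lerBlDl -[X in _ - X]mulr1 -mulrBr.
apply: (le_trans (ler_wpM2l (ltW n0) blo)).
rewrite mulrA ler_pdivrMr// powR_gt0//; lra.
Qed.

End asc.

(** * Cluster sizes of the random genealogy *)

Section occupation.
Context {R : realType}.
Implicit Types (h : nat -> R) (s : seq nat) (x : nat).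

Lemma sumr_const_seq (a : R) s : \sum_(j <- s) a = a *+ size s.
Proof. by rewrite big_const_seq count_predT iter_addr_0. Qed.

(** For a list of cluster labels this is the sum of [h] over the cluster sizes. *)
Definition occ h s : R := \sum_(j <- undup s) h (count_mem j s).

Lemma occ_subset h s (L : seq nat) : h 0 = 0 -> uniq L -> {subset s <= L} ->
  occ h s = \sum_(j <- L) h (count_mem j s).
Proof.
move=> h0 uL sL; rewrite [RHS](bigID (fun j => j \in s))/= [X in _ + X]big1_seq ?addr0.
  rewrite /occ -[in RHS]big_filter; apply: perm_big.
  apply: uniq_perm; [exact: undup_uniq|exact: filter_uniq|move=> j].
  rewrite mem_undup mem_filter; case: (boolP (j \in s)) => // /sL ->//.
by move=> j /andP[/count_memPn -> _].
Qed.

Lemma occ_rcons h s x : h 0 = 0 ->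
  occ h (rcons s x) = occ h s + (h (count_mem x s).+1 - h (count_mem x s)).
Proof.
move=> h0; set L := undup (rcons s x).
have uL : uniq L by exact: undup_uniq.
have xL : x \in L by rewrite mem_undup mem_rcons mem_head.
rewrite (@occ_subset h s L)//; last first.
  by move=> j js; rewrite mem_undup mem_rcons inE js orbT.
rewrite /occ -/L (bigD1_seq x)//= [in RHS](bigD1_seq x)//=.
rewrite -cats1 count_cat/= eqxx addn0 addn1.
rewrite [X in _ + X = _](_ : _ = \sum_(i <- L | i != x) h (count_mem i s)).
  by ring.
apply: eq_bigr => i ix.
by rewrite count_cat/= eq_sym (negbTE ix) !addn0.
Qed.

(** A uniformly chosen step belongs to a cluster with probability proportional to its size. *)
Lemma sum_count h s :
  \sum_(u <- s) h (count_mem u s) = occ (fun c => c%:R * h c) s.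
Proof.
rewrite -[LHS]big_undup_iterop_count; apply: eq_bigr => j _.
by rewrite mulr_natl.
Qed.

Lemma occ_natr s : occ (fun c => c%:R) s = (size s)%:R.
Proof.
transitivity (occ (fun c => c%:R * 1 : R) s).
  by apply: eq_bigr => j _; rewrite mulr1.
by rewrite -sum_count sumr_const_seq.
Qed.

Lemma occ_ge0 h s : (forall c, 0 <= h c) -> 0 <= occ h s.
Proof. by move=> h0; apply: sumr_ge0. Qed.

Lemma le_occ h k s : (forall c, h c <= k c) -> occ h s <= occ k s.
Proof. by move=> hk; apply: ler_sum. Qed.

Lemma occB h k s : occ (fun c => h c - k c) s = occ h s - occ k s.
Proof. by rewrite /occ sumrB. Qed.

Lemma occZ a h s : occ (fun c => a * h c) s = a * occ h s.
Proof. by rewrite /occ mulr_sumr. Qed.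

Lemma ler_norm_occ h s : `|occ h s| <= occ (fun c => `|h c|) s.
Proof. exact: ler_norm_sum. Qed.

End occupation.

Section tree_mean.
Context {R : realType} (p : R).
Implicit Types (F G : seq nat -> R) (s : seq nat).

(** A step is represented by the label of the cluster it belongs to.  The next step opens
    the cluster [m + 1] or copies the label of a uniformly chosen earlier step. *)
Definition tree_step (m : nat) F s : R :=
  (1 - p) * F (rcons s m.+1) + p / m%:R * \sum_(u <- s) F (rcons s u).

(** The expectation of [F] of the list of the labels of the first [n + 1] steps, the conditional
    expectations given the past being taken from the last step backwards. *)
Fixpoint tree_mean (n : nat) F : R :=
  if n is n'.+1 then tree_mean n' (tree_step n F) else F [:: 1%N].

Definition labelling (m : nat) s := (size s == m) && all (fun i => 0 < i <= m)%N s.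

Lemma labelling_rcons m s x : labelling m s -> (0 < x <= m.+1)%N ->
  labelling m.+1 (rcons s x).
Proof.
move=> /andP[/eqP sm /allP am] xm; apply/andP; rewrite size_rcons sm; split=> //.
apply/allP => i; rewrite mem_rcons inE => /predU1P[->//|/am/andP[-> /leqW]].
by [].
Qed.

Lemma labelling_mem m s x : labelling m s -> x \in s -> (0 < x <= m.+1)%N.
Proof. by move=> /andP[_ /allP am] /am/andP[-> /leqW]. Qed.

Lemma eq_tree_mean n F G : (forall s, labelling n.+1 s -> F s = G s) ->
  tree_mean n F = tree_mean n G.
Proof.
elim: n F G => [|n IH] F G FG /=; first by rewrite FG.
apply: IH => s sn; rewrite /tree_step FG; last first.
  by apply: labelling_rcons => //=; rewrite leqnn.
congr (_ + _ * _); apply: eq_big_seq => u us.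
by rewrite FG//; apply: labelling_rcons => //; exact: labelling_mem us.
Qed.

Lemma tree_meanD n F G :
  tree_mean n (fun s => F s + G s) = tree_mean n F + tree_mean n G.
Proof.
elim: n F G => //= n IH F G; rewrite -IH; apply: eq_tree_mean => s _.
by rewrite /tree_step big_split/=; ring.
Qed.

Lemma tree_mean_sum n (I : Type) (r : seq I) (F : I -> seq nat -> R) :
  tree_mean n (fun s => \sum_(i <- r) F i s) = \sum_(i <- r) tree_mean n (F i).
Proof.
elim: r => [|i r IH].
  rewrite big_nil; elim: n => [|n IH] /=; first by rewrite big_nil.
  rewrite -[RHS]IH; apply: eq_tree_mean => s _; rewrite /tree_step !big_nil.
  by rewrite (eq_bigr (fun=> 0)) => [|u _]; rewrite ?big_nil// big1// !mulr0 addr0.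
rewrite big_cons -IH -tree_meanD; apply: eq_tree_mean => s _.
by rewrite big_cons.
Qed.

Lemma tree_meanZ n a F : tree_mean n (fun s => a * F s) = a * tree_mean n F.
Proof.
elim: n F => //= n IH F; rewrite -IH; apply: eq_tree_mean => s _.
by rewrite /tree_step -mulr_sumr; ring.
Qed.

Lemma tree_mean_cst n a : tree_mean n (fun=> a) = a.
Proof.
elim: n => //= n IH; rewrite -[RHS]IH; apply: eq_tree_mean => s /andP[/eqP sn _].
by rewrite /tree_step sumr_const_seq sn; field; rewrite nat1r pnatr_eq0.
Qed.

Hypothesis p01 : 0 <= p <= 1.

Lemma le_tree_mean n F G : (forall s, labelling n.+1 s -> F s <= G s) ->
  tree_mean n F <= tree_mean n G.
Proof.
move: p01 => /andP[p0 p1].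
elim: n F G => [|n IH] F G FG /=; first by rewrite FG.
apply: IH => s sn; apply: lerD.
  rewrite ler_wpM2l ?subr_ge0// FG//.
  by apply: labelling_rcons => //=; rewrite leqnn.
rewrite ler_wpM2l ?divr_ge0// big_seq [leRHS]big_seq; apply: ler_sum => u us.
by rewrite FG//; apply: labelling_rcons => //; exact: labelling_mem us.
Qed.

Lemma ler_norm_tree_mean n F : `|tree_mean n F| <= tree_mean n (fun s => `|F s|).
Proof.
rewrite ler_norml -mulN1r -tree_meanZ; apply/andP; split.
  by apply: le_tree_mean => s _; rewrite mulN1r lerNl -normrN ler_norm.
by apply: le_tree_mean => s _; exact: ler_norm.
Qed.

End tree_mean.

Section moments.
Context {R : realType} (p a : R).
Hypotheses (p01 : 0 < p < 1) (a2 : 0 < a <= 2) (ap1 : a * p = 1).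

Let p01' : 0 <= p <= 1. Proof. by case/andP: p01 => *; apply/andP; split; lra. Qed.
Let a0 : 0 <= a. Proof. by case/andP: a2 => *; lra. Qed.

Local Notation V b := (occ (asc b)).
Local Notation M := (tree_mean p).

(** The sum over the earlier steps turns into a sum over clusters weighted by their sizes,
    which cancels the denominator in the increment of [asc]. *)
Lemma tree_step_asc b m s : labelling m.+1 s ->
  tree_step p m.+1 (V b) s = (1 + p * b / m.+1%:R) * V b s + (1 - p).
Proof.
move=> /andP[/eqP sm /allP am]; rewrite /tree_step occ_rcons//.
have -> : count_mem m.+2 s = 0%N.
  by apply/count_memPn/negP => /am; rewrite ltnn andbF.
rewrite asc1 asc0.
under eq_bigr do rewrite occ_rcons//.
rewrite big_split/= sumr_const_seq sm.
rewrite (sum_count (fun c => asc b c.+1 - asc b c)).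
rewrite [occ (fun c => _ * _) s](_ : _ = b * V b s); last first.
  by rewrite -occZ; apply: eq_bigr => j _; exact: ascS.
by rewrite -mulr_natl; field; rewrite nat1r pnatr_eq0.
Qed.

(** Squared increments of [asc a] grow like [c^(2 a - 2)]; comparing ratios of consecutive
    terms, the induction closes because [(c + a)^2 <= (c + 2 a) (c + 1)] when [a <= 2]. *)
Lemma asc_sqr_le c : c%:R * (asc a c.+1 - asc a c) ^+ 2 <= a ^+ 2 * asc (2 * a) c.
Proof.
case: c => [|c]; first by rewrite mul0r asc0 mulr0.
have c0 : 0 < c.+1%:R :> R by [].
rewrite -(ler_pM2l c0) mulrA -expr2 -exprMn ascS exprMn [leRHS]mulrCA ler_wpM2l ?sqr_ge0//.
elim: c {c0} => [|c IH]; first by rewrite !asc1 expr1n mulr1.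
have c0 : 0 < c.+1%:R :> R by [].
have step b : asc b c.+2 = asc b c.+1 * (1 + b / c.+1%:R).
  by rewrite /asc big_ord_recr.
rewrite !step exprMn.
apply: (@le_trans _ _ (c.+1%:R * asc (2 * a) c.+1 * (1 + a / c.+1%:R) ^+ 2)).
  by rewrite ler_wpM2r// sqr_ge0.
rewrite [leRHS](_ : _ = asc (2 * a) c.+1 * (c.+2%:R * (1 + 2 * a / c.+1%:R)));
  last by ring.
rewrite [leLHS](_ : _ = asc (2 * a) c.+1 * (c.+1%:R * (1 + a / c.+1%:R) ^+ 2));
  last by ring.
rewrite ler_wpM2l ?asc_ge0 ?mulr_ge0//.
rewrite -[c.+2%:R]natr1; set x := c.+1%:R in c0 *.
rewrite -subr_ge0 [X in 0 <= X](_ : _ = (x + 2 * a - a ^+ 2) / x); last by field; rewrite gt_eqF.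
rewrite divr_ge0 ?(ltW c0)//.
have : 0 <= a * (2 - a) by rewrite mulr_ge0// subr_ge0; case/andP: a2.
by rewrite expr2; lra.
Qed.

Definition hsum n : R := \sum_(k < n) k.+1%:R^-1.

Lemma hsumS n : hsum n.+1 = hsum n + n.+1%:R^-1. Proof. by rewrite /hsum big_ord_recr. Qed.

(** Divided by [n], the recursion from [tree_step_asc] with [p a = 1] adds [(1 - p) / n]. *)
Lemma tree_mean_asc n : M n (V a) = n.+1%:R * (p + (1 - p) * hsum n.+1).
Proof.
elim: n => [|n IH].
  by rewrite /= /occ/= big_seq1/= big_ord0 /hsum big_ord1 invr1; ring.
rewrite /= (eq_tree_mean _ (@tree_step_asc a n)).
rewrite tree_meanD tree_meanZ tree_mean_cst IH (mulrC p) ap1 [hsum n.+2]hsumS -[n.+2%:R]natr1.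
have h1 : n.+1%:R != 0 :> R by rewrite pnatr_eq0.
have h2 : n.+1%:R + 1 != 0 :> R by rewrite natr1 pnatr_eq0.
move: n.+1%:R h1 h2 => x h1 h2.
by field; rewrite h1 h2.
Qed.

(** With [p (2 a) = 2] the recursion multiplies by [1 + 2 / n], which is the growth of [n^2]. *)
Lemma tree_mean_asc2 n : M n (V (2 * a)) <= n.+1%:R ^+ 2.
Proof.
elim: n => [|n IH].
  by rewrite /= /occ/= big_seq1/= big_ord0 expr1n.
rewrite /= (eq_tree_mean _ (@tree_step_asc (2 * a) n)).
rewrite tree_meanD tree_meanZ tree_mean_cst (mulrCA p) (mulrC p) ap1 mulr1.
have x0 : 0 < n.+1%:R :> R by rewrite ltr0n.
rewrite -[n.+2%:R]natr1; move: n.+1%:R x0 IH => x x0 IH.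
have : (1 + 2 / x) * M n (V (2 * a)) <= (1 + 2 / x) * x ^+ 2.
  by rewrite ler_wpM2l// addr_ge0// divr_ge0// ltW.
rewrite [leRHS](_ : _ = x ^+ 2 + 2 * x); last by field; rewrite gt_eqF.
case/andP: p01 => p0 p1; move: (_ * M n _) => y B.
rewrite [leRHS](_ : _ = x ^+ 2 + 2 * x + 1); last by ring.
lra.
Qed.

Lemma tree_step_sqr m s : labelling m.+1 s ->
  tree_step p m.+1 (fun s => V a s ^+ 2) s <=
  (1 + 2 / m.+1%:R) * V a s ^+ 2 + 2 * (1 - p) * V a s + (1 - p) +
  p / m.+1%:R * (a ^+ 2 * V (2 * a) s).
Proof.
move=> ls; move: (ls) => /andP[/eqP sm /allP am]; rewrite /tree_step occ_rcons//.
have -> : count_mem m.+2 s = 0%N.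
  by apply/count_memPn/negP => /am; rewrite ltnn andbF.
rewrite asc1 asc0.
pose D u := asc a (count_mem u s).+1 - asc a (count_mem u s).
have D1 : \sum_(u <- s) D u = a * V a s.
  rewrite (sum_count (fun c => asc a c.+1 - asc a c)) -occZ.
  by apply: eq_bigr => j _; exact: ascS.
have D2 : \sum_(u <- s) D u ^+ 2 <= a ^+ 2 * V (2 * a) s.
  rewrite (sum_count (fun c => (asc a c.+1 - asc a c) ^+ 2)) -occZ.
  by apply: le_occ => c; exact: asc_sqr_le.
rewrite (eq_bigr (fun u => (V a s ^+ 2 + (2 * V a s) * D u) + D u ^+ 2)); last first.
  by move=> u _; rewrite occ_rcons// -/(D u); ring.
rewrite big_split/= big_split/= sumr_const_seq sm -mulr_sumr D1 -[V a s ^+ 2 *+ _]mulr_natl.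
have x0 : 0 < m.+1%:R :> R by rewrite ltr0n.
set x := m.+1%:R in x0 *.
have px : 0 <= p / x by case/andP: p01' => *; rewrite divr_ge0// ltW.
apply: (@le_trans _ _ ((1 - p) * (V a s + (1 - 0)) ^+ 2 + p / x *
   (x * V a s ^+ 2 + 2 * V a s * (a * V a s) + a ^+ 2 * V (2 * a) s))).
  by rewrite lerD2l ler_wpM2l// lerD2l.
rewrite le_eqVlt; apply/orP; left; apply/eqP.
rewrite subr0 [in 1 + 2 / x](_ : 2 = 2 * (a * p)); last by rewrite ap1 mulr1.
by field; rewrite gt_eqF.
Qed.

Lemma hsum_ge0 n : 0 <= hsum n.
Proof. by apply: sumr_ge0 => k _; rewrite invr_ge0. Qed.

(** The martingale part: the variance is multiplied by at most [1 + 2 / n] and increases by at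
    most [3 n], and [3 n^2 (1 + ... + 1 / n)] dominates this recursion. *)
Lemma tree_mean_asc_var n :
  M n (fun s => V a s ^+ 2) <= (M n (V a)) ^+ 2 + 3 * n.+1%:R ^+ 2 * hsum n.+1.
Proof.
elim: n => [|n IH].
  rewrite /= lerDl mulr_ge0 ?hsum_ge0//.
have E : forall q r t : R, M n (fun s => r * V a s ^+ 2 + 2 * q * V a s + q +
    t * (a ^+ 2 * V (2 * a) s)) = r * M n (fun s => V a s ^+ 2) +
    2 * q * M n (V a) + q + t * (a ^+ 2 * M n (V (2 * a))).
  by move=> q r t; rewrite !tree_meanD tree_mean_cst !tree_meanZ.
have := le_tree_mean p01' (@tree_step_sqr n); rewrite E => {E}.
rewrite [leLHS]/= => /le_trans; apply.
have q := tree_mean_asc2 n.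
have vE : M n.+1 (V a) = (1 + n.+1%:R^-1) * M n (V a) + (1 - p).
  rewrite /= (eq_tree_mean _ (@tree_step_asc a n)).
  by rewrite tree_meanD tree_meanZ tree_mean_cst (mulrC p) ap1 mul1r.
have v0 : 0 <= M n (V a).
  rewrite -(tree_mean_cst p n 0); apply: le_tree_mean => // s _.
  by apply: occ_ge0 => c; exact: asc_ge0.
rewrite vE hsumS -[n.+2%:R]natr1.
have h0 := hsum_ge0 n.+1.
have x1 : 1 <= n.+1%:R :> R by rewrite ler1n.
set x := n.+1%:R in x1 q IH *.
set h := hsum _ in h0 IH *; set v := M n (V a) in v0 IH *.
set m := M n (fun s => V a s ^+ 2) in IH *.
have x0 : 0 < x by lra.
case/andP: p01 => p0 p1; case/andP: a2 => a0' a2'.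
have Q : p / x * (a ^+ 2 * M n (V (2 * a))) <= 2 * x.
  apply: (@le_trans _ _ (p / x * (a ^+ 2 * x ^+ 2))).
    by rewrite ler_wpM2l ?divr_ge0 ?(ltW p0) ?(ltW x0)// ler_wpM2l ?sqr_ge0.
  rewrite [leLHS](_ : _ = (a * p) * a * x); last by field; rewrite gt_eqF.
  by rewrite ap1 mul1r ler_wpM2r// ltW.
have Mm : (1 + 2 / x) * m <= (1 + 2 / x) * (v ^+ 2 + 3 * x ^+ 2 * h).
  by rewrite ler_wpM2l// addr_ge0// divr_ge0// ltW.
(* the harmonic sum gains 1 / (x + 1) in this step *)
have E : (x + 1) ^+ 2 * (h + (x + 1)^-1) = (x + 1) ^+ 2 * h + (x + 1).
  by field; rewrite gt_eqF//; lra.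
rewrite [3 * _ * _](_ : _ = 3 * ((x + 1) ^+ 2 * h + (x + 1))); last by rewrite -E mulrA.
have Mm' : (1 + 2 / x) * (v ^+ 2 + 3 * x ^+ 2 * h) =
   v ^+ 2 + 2 * (v ^+ 2 / x) + 3 * (x ^+ 2 * h) + 6 * (x * h).
  by field; rewrite gt_eqF.
rewrite [X in _ <= X](_ : _ = v ^+ 2 + 2 * (v ^+ 2 / x) + (v / x) ^+ 2 +
   2 * (1 - p) * v + 2 * ((1 - p) * (v / x)) + (1 - p) ^+ 2 +
   (3 * (x ^+ 2 * h) + 6 * (x * h) + 3 * h + 3 * x + 3)); last first.
  by field; rewrite gt_eqF.
have a1 : 0 <= (v / x) ^+ 2 by exact: sqr_ge0.
have a3 : 0 <= (1 - p) * (v / x) by rewrite mulr_ge0 ?divr_ge0 ?(ltW x0)//; lra.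
have a4 : 0 <= (1 - p) ^+ 2 by exact: sqr_ge0.
rewrite Mm' in Mm; move: Mm Q a1 a3 a4 h0.
clearbody h x.
move: (_ * m : R) (_ * (a ^+ 2 * _) : R) ((v / x) ^+ 2 : R) (_ * (v / x) : R)
  ((1 - p) ^+ 2 : R) (v ^+ 2 / x : R) (x ^+ 2 * h : R) (x * h : R)
  (2 * (1 - p) * v : R) (v ^+ 2 : R).
clear -x1 p0 p1; move=> *; lra.
Qed.

Lemma ln_le_hsum n : ln n.+1%:R <= hsum n.
Proof.
elim: n => [|n IH]; first by rewrite ln1 hsum_ge0.
rewrite hsumS; have x0 : 0 < n.+1%:R :> R by rewrite ltr0n.
have -> : n.+2%:R = n.+1%:R * (1 + n.+1%:R^-1) :> R.
  by rewrite mulrDr mulfV ?gt_eqF// mulr1 natr1.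
have i0 : 0 < n.+1%:R^-1 :> R by rewrite invr_gt0.
rewrite lnM ?posrE ?addr_gt0//.
by rewrite lerD// le_ln1Dx// (lt_trans _ i0)// ltrN10.
Qed.

Lemma hsum_le_ln n : hsum n.+1 <= 1 + ln n.+1%:R.
Proof.
elim: n => [|n IH]; first by rewrite ln1 /hsum big_ord1 invr1 addr0.
rewrite hsumS; have x0 : 0 < n.+1%:R :> R by rewrite ltr0n.
have y1 : 1 < n.+2%:R :> R by rewrite ltr1n.
have E : n.+1%:R = n.+2%:R * (1 - n.+2%:R^-1) :> R.
  by rewrite mulrBr mulfV ?gt_eqF ?ltr0n// mulr1 -[n.+2%:R]natr1 addrK.
have i1 : n.+2%:R^-1 < 1 :> R by rewrite invf_lt1//; lra.
move: IH; rewrite E lnM ?posrE ?subr_gt0//.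
have : ln (1 - n.+2%:R^-1) <= - n.+2%:R^-1 :> R by rewrite le_ln1Dx// ltrN2.
by move=> h1 h2; rewrite -lerBrDr (le_trans h2)// -addrA lerD2l lerD2l.
Qed.

(** Cauchy-Schwarz, in the form [2 |y| <= y^2 / q + q] with [q] of the order of the standard
    deviation. *)
Lemma tree_mean_asc_dev n :
  M n (fun s => `|V a s - M n (V a)|) <= 2 * n.+1%:R * Num.sqrt (hsum n.+1).
Proof.
set v := M n (V a); set x : R := n.+1%:R; set r := Num.sqrt _.
have x0 : 0 < x by rewrite ltr0n.
have Hpos : 0 < hsum n.+1 by rewrite hsumS ltr_wpDl ?hsum_ge0// invr_gt0.
have r0 : 0 < r by rewrite sqrtr_gt0.
have r2 : r ^+ 2 = hsum n.+1 by rewrite sqr_sqrtr// ltW.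
apply: (@le_trans _ _ (M n (fun s =>
   (2 * x * r)^-1 * ((V a s ^+ 2 + (- (2 * v)) * V a s) + v ^+ 2) + x * r / 2))).
  apply: le_tree_mean => // s _.
  have xr : 0 < 2 * x * r by rewrite !mulr_gt0.
  rewrite -(ler_pM2l xr) mulrDr mulrA mulfV ?gt_eqF// mul1r.
  rewrite [X in _ <= X + _](_ : _ = `|V a s - v| ^+ 2); last first.
    by rewrite real_normK ?num_real//; ring.
  have : 0 <= (`|V a s - v| - x * r) ^+ 2 by exact: sqr_ge0.
  by rewrite sqrrB -[_ *+ 2]mulr_natl => *; lra.
rewrite !(tree_meanD, tree_meanZ, tree_mean_cst).
have B := tree_mean_asc_var n.
rewrite -/v -r2 -/x in B *.
apply: (@le_trans _ _ ((2 * x * r)^-1 * (3 * x ^+ 2 * r ^+ 2) + x * r / 2)).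
  rewrite lerD2r ler_wpM2l//; first by rewrite invr_ge0 !mulr_ge0// ltW.
  by rewrite [v ^+ 2]expr2 in B *; lra.
by rewrite le_eqVlt; apply/orP; left; apply/eqP; field; rewrite !gt_eqF.
Qed.

(** The three errors, of orders [n], [n sqrt (ln n)] and [n]: replacing powers by [asc],
    fluctuations, and the harmonic sum against the logarithm. *)
Lemma tree_mean_powR n : 1 <= a ->
  M n (fun s => `|occ (fun c => c%:R `^ a) s -
     (1 - p) * Gamma (a + 1) * (n.+1%:R * ln n.+1%:R)|)
  <= n.+1%:R * (Gamma (a + 1) * (2 * Num.sqrt (1 + ln n.+1%:R) + 1) + 1).
Proof.
move=> a1; set G := Gamma (a + 1); set x : R := n.+1%:R; set l := ln _.
have G0 : 0 <= G by exact: Gamma_ge0.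
have x0 : 0 < x by rewrite ltr0n.
case/andP: p01 => p0 p1.
have Hl : hsum n.+1 <= 1 + l by exact: hsum_le_ln.
have lH : l <= hsum n.+1.
  by apply: (le_trans (ln_le_hsum n)); rewrite hsumS lerDl invr_ge0.
have dl : `|M n (V a) - (1 - p) * (x * l)| <= x.
  rewrite tree_mean_asc -/x [X in `|X|](_ : _ = x * (p + (1 - p) * (hsum n.+1 - l)));
    last by ring.
  rewrite normrM gtr0_norm// -[leRHS]mulr1 ler_wpM2l ?(ltW x0)// ger0_norm.
    have : (1 - p) * (hsum n.+1 - l) <= (1 - p) * 1 by rewrite ler_wpM2l//; lra.
    by move=> *; lra.
  by rewrite addr_ge0 ?(ltW p0)// mulr_ge0//; lra.
apply: (@le_trans _ _ (M n (fun s => (G * `|V a s - M n (V a)|) + (G * x + x)))).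
  apply: le_tree_mean => // s /andP[/eqP sn _].
  set W := occ _ s.
  have WV : `|W - G * V a s| <= x.
    rewrite /W -occZ -occB; apply: (le_trans (ler_norm_occ _ _)).
    rewrite /x -sn -[leRHS]occ_natr; apply: le_occ => c.
    by apply: powR_asc_le; rewrite a1; case/andP: a2.
  rewrite [X in `|X|](_ : _ = (W - G * V a s) +
     (G * (V a s - M n (V a)) + G * (M n (V a) - (1 - p) * (x * l)))); last by ring.
  apply: (le_trans (ler_normD _ _)); rewrite [leRHS]addrA [leRHS]addrC lerD//.
  apply: (le_trans (ler_normD _ _)); rewrite !normrM (ger0_norm G0) lerD//.
  by rewrite ler_wpM2l.
rewrite tree_meanD tree_meanZ tree_mean_cst.
have := tree_mean_asc_dev n; rewrite -/x => B.
have B' : Num.sqrt (hsum n.+1) <= Num.sqrt (1 + l) by rewrite ler_wsqrtr.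
apply: (@le_trans _ _ (G * (2 * x * Num.sqrt (1 + l)) + (G * x + x))).
  rewrite lerD2r ler_wpM2l// (le_trans B)// ler_wpM2l// mulr_ge0// ltW//.
by rewrite le_eqVlt; apply/orP; left; apply/eqP; ring.
Qed.

End moments.

(** * Independence *)

Section staircase.
Context {R : realType}.

(** The sum is the integer part of [z]. *)
Lemma staircase_bound (K : nat) (z : R) : 0 <= z <= K%:R ->
  `|z - \sum_(i < K) (i.+1%:R <= z)%R%:R| <= 1.
Proof.
elim: K => [|K IH] /andP[z0 zK].
  by rewrite big_ord0 subr0 ger0_norm// (le_trans zK).
rewrite big_ord_recr/=; have [zK'|Kz] := leP z K%:R.
  have -> : (K.+1%:R <= z) = false.
    by apply/negbTE; rewrite -ltNge (le_lt_trans zK')// ltr_nat.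
  rewrite addr0.
  by apply: IH; rewrite z0.
rewrite (eq_bigr (fun=> 1)) => [|i _]; last first.
  by rewrite (le_trans _ (ltW Kz))// ler_nat.
rewrite sumr_const card_ord.
have [zK1|zK1] := leP K.+1%:R z.
  have -> : z = K.+1%:R by apply/le_anti; rewrite zK.
  by rewrite -[K.+1%:R]natr1 subrr normr0.
rewrite addr0 ger0_norm; last by rewrite subr_ge0 ltW.
by rewrite lerBlDr addrC natr1 ltW.
Qed.

End staircase.

Section independent_of_one.
Context d (T : measurableType d) (R : realType) (P : probability T R).

(** It is enough to know the product rule for indicators of events about [y]: a bounded [y] is
    a uniform limit of staircase combinations of the events [y >= (i + 1) / M - 1]. *)
Lemma mean_mul_indep (h y : T -> R) : bmfun h -> measurable_fun setT y ->
  (forall w, `|y w| <= 1) ->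
  (forall V : set R, measurable V -> \int[P]_w (h w * \1_(y @^-1` V) w) =
     fine (P (y @^-1` V)) * \int[P]_w h w) ->
  \int[P]_w (h w * y w) = (\int[P]_w y w) * \int[P]_w h w.
Proof.
move=> bh my y1 H; have bmy : bmfun y by split => //; exists 1.
have [B B0 hB] : exists2 B, 0 <= B & forall w, `|h w| <= B.
  by have [_ [B hB]] := bh; exists `|B| => // w; exact: le_trans (hB w) (ler_norm _).
(* y + 1 is nonnegative, and at most 2 M steps of height 1 / M exhaust it *)
pose V (M i : nat) : set R := [set r | i.+1%:R <= (r + 1) * M.+1%:R].
have mV M i : measurable (V M i).
  rewrite (_ : V M i = `[i.+1%:R / M.+1%:R - 1, +oo[%classic).
    exact: measurable_itv.
  apply/seteqP; split => r /=; rewrite in_itv/= andbT lerBlDr ler_pdivrMr ?ltr0n//.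
have mA M i : measurable (y @^-1` V M i).
  by rewrite -[X in measurable X]setTI; exact: my.
pose I M i : T -> R := \1_(y @^-1` V M i).
have bI M i : bmfun (I M i) by exact: bmfun_indic.
pose Y M w := M.+1%:R^-1 * (\sum_(i < 2 * M.+1) I M i w) - 1.
have bS M : bmfun (fun w => \sum_(i < 2 * M.+1) I M i w) by exact: bmfun_sum.
have bY M : bmfun (Y M).
  apply: (@bmfunB _ _ _ (fun w => M.+1%:R^-1 * (\sum_(i < 2 * M.+1) I M i w)) (cst 1)).
    exact: bmfunZ.
  exact: bmfun_cst.
have Yy M w : `|y w - Y M w| <= M.+1%:R^-1.
  have M0 : 0 < M.+1%:R :> R by rewrite ltr0n.
  have yw : 0 <= (y w + 1) * M.+1%:R <= (2 * M.+1)%:R.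
    have := y1 w; rewrite ler_norml => /andP[l u].
    rewrite mulr_ge0 ?(ltW M0)//=; last by lra.
    by rewrite natrM ler_pM2r//; lra.
  have := staircase_bound yw.
  rewrite -(ler_pM2l (_ : 0 < M.+1%:R^-1)) ?invr_gt0// mulr1.
  rewrite -[X in X * `|_|]gtr0_norm ?invr_gt0// -normrM.
  rewrite (_ : M.+1%:R^-1 * _ = y w - Y M w)//.
  rewrite /Y mulrBr mulrCA mulVf ?gt_eqF// mulr1 (_ : \sum_(i < 2 * M.+1) I M i w =
    \sum_(i < 2 * M.+1) (i.+1%:R <= (y w + 1) * M.+1%:R)%R%:R); last first.
    apply: eq_bigr => i _; rewrite /I indicE; congr (_%:R).
    by congr nat_of_bool; apply/idP/idP; rewrite inE.
  by ring.
have HY M : \int[P]_w (h w * Y M w) = (\int[P]_w Y M w) * \int[P]_w h w.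
  have -> : \int[P]_w (h w * Y M w) =
     \int[P]_w (M.+1%:R^-1 * (\sum_(i < 2 * M.+1) (h w * I M i w)) - h w).
    by apply: eq_Rintegral => w _; rewrite /Y mulrBr mulr1 mulrCA mulr_sumr.
  rewrite meanB//; last by apply: bmfunZ; apply: bmfun_sum => i; exact: bmfunM.
  rewrite meanZ; last by apply: bmfun_sum => i; exact: bmfunM.
  rewrite mean_sum; last by move=> i; exact: bmfunM.
  rewrite (@meanB _ _ _ P (fun w => M.+1%:R^-1 * (\sum_(i < 2 * M.+1) I M i w)) (cst 1));
    [|exact: bmfunZ|exact: bmfun_cst].
  rewrite (mean_cst P) meanZ// mean_sum//.
  under eq_bigr do rewrite H//.
  rewrite -mulr_suml mulrBl mul1r mulrA; congr (_ * _ * _ - _).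
  by apply: eq_bigr => i _; rewrite mean_indic.
apply/eqP; rewrite -subr_eq0 -normr_le0; apply/ler_addgt0Pl => e e0; rewrite addr0.
pose M := Num.truncn (2 * B / e).
have D M' : `|\int[P]_w (h w * y w) - (\int[P]_w y w) * \int[P]_w h w| <= 2 * B * M'.+1%:R^-1.
  rewrite (_ : _ - _ = \int[P]_w (h w * (y w - Y M' w)) -
      (\int[P]_w (y w - Y M' w)) * \int[P]_w h w); last first.
    have -> : \int[P]_w (h w * (y w - Y M' w)) = \int[P]_w (h w * y w - h w * Y M' w).
      by apply: eq_Rintegral => w _; rewrite mulrBr.
    rewrite (meanB P (bmfunM bh bmy) (bmfunM bh (bY M'))) (meanB P bmy (bY M')).
    by rewrite HY; ring.
  have M0 : 0 <= M'.+1%:R^-1 :> R by rewrite invr_ge0.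
  rewrite (le_trans (ler_normB _ _))// (_ : 2 * B * _ = B * M'.+1%:R^-1 + M'.+1%:R^-1 * B);
    last by ring.
  apply: lerD.
    apply: mean_bound; first by apply: bmfunM => //; exact: bmfunB.
    by move=> w; rewrite normrM ler_pM.
  by rewrite normrM ler_pM// mean_bound//; exact: bmfunB.
apply: (le_trans (D M)); rewrite ler_pdivrMr ?ltr0n// [leRHS]mulrC -ler_pdivrMr//.
by rewrite ltW// truncnS_gt.
Qed.

End independent_of_one.

Section linear_forms.
Context {R : realType} {dim : nat}.

Lemma continuous_inner (theta : 'rV[R]_dim) : continuous (fun v : 'rV[R]_dim => inner theta v).
Proof.
rewrite /inner; elim: (index_enum _) => [|i r IH] v.
  by under eq_fun do rewrite big_nil; exact: cst_continuous.
rewrite (_ : (fun u : 'rV[R]_dim => \sum_(j <- i :: r) theta 0 j * u 0 j) =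
  (fun u => theta 0 i * u 0 i + \sum_(j <- r) theta 0 j * u 0 j)); last first.
  by apply/funext => u; rewrite big_cons.
have cv : {for v, continuous (fun u : 'rV[R]_dim => u 0 i)}.
  exact: (@coord_continuous R 1 dim 0 i v).
apply: (@continuousD R R^o 'rV[R]_dim (fun u => theta 0 i * u 0 i)); last exact: IH.
by apply: continuousM; [exact: cst_continuous|exact: cv].
Qed.

Lemma measurable_inner (theta : 'rV[R]_dim) :
  measurable_fun setT (fun v : borel_rV R dim => inner theta v).
Proof.
apply: (@measurability _ _ _ _ setT (fun v : borel_rV R dim => inner theta v)
  (@RGenOpens.G R) (RGenOpens.measurableE R)).
move=> _ [_ [a [b ->] <-]]; rewrite setTI; apply: sub_sigma_algebra.
have /continuousP := @continuous_inner theta; apply; exact: interval_open.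
Qed.

Lemma enormZ (c : R) (theta : 'rV[R]_dim) : 0 <= c -> enorm (c *: theta) = c * enorm theta.
Proof.
move=> c0; rewrite /enorm innerZl innerZr mulrA -expr2 sqrtrM ?sqr_ge0//.
by rewrite sqrtr_sqr ger0_norm.
Qed.

Lemma enorm_ge0 (theta : 'rV[R]_dim) : 0 <= enorm theta.
Proof. exact: sqrtr_ge0. Qed.

End linear_forms.

Section swim.
Context (R : realType) (dim : nat) (alpha p : R).
Context (d : measure_display) (T : measurableType d) (P : probability T R).
Context (xi : nat -> {RV P >-> borel_rV R dim}) (eps : nat -> {RV P >-> bool}).
Context (U : nat -> {RV P >-> nat}) (Y S : nat -> T -> 'rV[R]_dim).
Hypothesis hS : shark_random_swim alpha p xi eps U Y S.
Implicit Types (J : seq source) (A : source -> set T).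

Definition source_events (s : source) : set (set T) :=
  match s with
  | Step n => sigma_of (xi n)
  | Coin n => sigma_of (eps n)
  | Index n => sigma_of (U n)
  end.

Definition events_ok J A := uniq J /\
  forall i, i \in J -> used_source i /\ source_events i (A i).

(** The indicator of the intersection of the events [A j], in a form suited to induction
    on [J]. *)
Definition joint_indic J A (w : T) : R := \prod_(j <- J) \1_(A j) w.

Definition joint_prob J A : R := \prod_(j <- J) fine (P (A j)).

Definition set_event A (j : source) (B : set T) (i : source) := if i == j then B else A i.

Lemma source_events_measurable s (B : set T) : source_events s B -> measurable B.
Proof.
by case: s => n /= [C mC <-]; rewrite setTI -[X in measurable X]setTI; exact: measurable_funP.
Qed.

Lemma joint_cons J A j B : j \notin J ->
  joint_indic (j :: J) (set_event A j B) = (fun w => joint_indic J A w * \1_B w).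
Proof.
move=> jJ; apply/funext => w; rewrite /joint_indic big_cons /set_event eqxx mulrC; congr (_ * _).
by apply: eq_big_seq => i iJ; case: eqP => // ij; rewrite -ij iJ in jJ.
Qed.

Lemma jointP_cons J A j B : j \notin J ->
  joint_prob (j :: J) (set_event A j B) = joint_prob J A * fine (P B).
Proof.
move=> jJ; rewrite /joint_prob big_cons /set_event eqxx mulrC; congr (_ * _).
by apply: eq_big_seq => i iJ; case: eqP => // ij; rewrite -ij iJ in jJ.
Qed.

Lemma events_ok_cons J A j B : events_ok J A -> j \notin J -> used_source j ->
  source_events j B -> events_ok (j :: J) (set_event A j B).
Proof.
move=> [uJ HJ] jJ uj jB; split; first by rewrite /= jJ.
move=> i; rewrite inE /set_event; have [->//|ij /= iJ] := eqVneq i j.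
exact: HJ.
Qed.

Lemma bmfun_joint J A : events_ok J A -> bmfun (joint_indic J A).
Proof.
move=> [_ HJ]; rewrite /joint_indic; elim: J HJ => [|j J IH] HJ.
  by under eq_fun do rewrite big_nil; exact: bmfun_cst.
under eq_fun do rewrite big_cons; apply: bmfunM.
  by apply: bmfun_indic; apply: (@source_events_measurable j); apply: (HJ j _).2; rewrite mem_head.
by apply: IH => i iJ; apply: HJ; rewrite inE iJ orbT.
Qed.

Lemma mean_joint J A : events_ok J A -> \int[P]_w joint_indic J A w = joint_prob J A.
Proof.
move=> okJ; have [uJ HJ] := okJ.
have mJ : measurable (\bigcap_(i in [set` J]) A i).
  by apply: fin_bigcap_measurable => // i iJ; apply: source_events_measurable (HJ i iJ).2.
have -> : joint_indic J A = \1_(\bigcap_(i in [set` J]) A i).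
  apply/funext => w; rewrite /joint_indic indicE.
  have [wJ|] := boolP (w \in _).
    rewrite big1_seq// => i /= iJ; rewrite indicE mem_set//.
    by move: wJ; rewrite inE => /(_ i iJ).
  rewrite notin_setE => /existsNP[i /not_implyP[iJ nA]].
  by rewrite (big_rem i)//= indicE memNset// mul0r.
rewrite mean_indic// (srs_independent hS)//.
rewrite /joint_prob -[RHS]/(fine (_)%:E) -prodEFin; congr fine.
rewrite big_seq [RHS]big_seq; apply: eq_bigr => i iJ.
by rewrite fineK// fin_num_measure//; apply: source_events_measurable (HJ i iJ).2.
Qed.

Variable theta : 'rV[R]_dim.

Let x (j : nat) (w : T) : R := inner theta (xi j w).

Let mx j : measurable_fun setT (x j).
Proof. exact: (measurableT_comp (measurable_inner theta)). Qed.

Definition step_charfun (c : nat) : R := expR (- (enorm theta `^ alpha * c%:R `^ alpha)).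

Lemma mean_xi (g : R -> R) j (eta : 'rV[R]_dim) : (1 <= j)%N -> continuous g ->
  (forall u, `|g u| <= 1) ->
  \int[P]_w g (inner eta (xi j w)) = \int[P]_w g (inner eta (xi 1%N w)).
Proof.
move=> j1 cg g1.
have mg : measurable_fun setT (fun v : borel_rV R dim => g (inner eta v)).
  by apply: measurableT_comp (measurable_inner eta); exact: continuous_measurable_fun.
have D k : \int[P]_w g (inner eta (xi k w)) =
    fine (\int[distribution P (xi k)]_v (g (inner eta v))%:E).
  rewrite integral_distribution//; first exact/measurable_EFinP.
  apply: (@bmfun_integrable _ _ _ _ (fun w => g (inner eta (xi k w)))).
  split; last by exists 1.
  exact: (measurableT_comp mg).
rewrite !D; congr fine; apply: eq_measure_integral => B mB _.
exact: (srs_xi_identically_distributed hS).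
Qed.

Lemma mean_cos_xi j (c : nat) : (1 <= j)%N -> \int[P]_w cos (c%:R * x j w) = step_charfun c.
Proof.
move=> j1; have := srs_xi_charfun hS (c%:R *: theta).
rewrite enormZ// powRM ?enorm_ge0// mulrC => -[+ _].
rewrite -/(step_charfun c) => <-.
under eq_Rintegral do rewrite /x -innerZl.
by rewrite (mean_xi _ j1 (@continuous_cos R) (@cos_max R)).
Qed.

Lemma mean_sin_xi j (c : nat) : (1 <= j)%N -> \int[P]_w sin (c%:R * x j w) = 0.
Proof.
move=> j1; have := srs_xi_charfun hS (c%:R *: theta).
move=> -[_ H].
under eq_Rintegral do rewrite /x -innerZl.
by rewrite (mean_xi _ j1 (@continuous_sin R) (@sin_max R)).
Qed.

Let lin (c : nat -> nat) (L : seq nat) (w : T) : R := \sum_(j <- L) (c j)%:R * x j w.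

Let mlin c L : measurable_fun setT (lin c L).
Proof.
rewrite /lin; elim: L => [|j L IH].
  by under eq_fun do rewrite big_nil; exact: measurable_cst.
by under eq_fun do rewrite big_cons; apply: measurable_funD => //; exact: measurable_funM.
Qed.

(** The innovations are split off one at a time with the addition formulas; the product rule
    needed by [mean_mul_indep] is the induction hypothesis with one more event, so [J] and [A]
    are generalised. *)
Lemma mean_trig_steps (c : nat -> nat) (L : seq nat) J A :
  all (leq 1) L -> uniq (map Step L ++ J) -> events_ok J A ->
  \int[P]_w (cos (lin c L w) * joint_indic J A w) =
    (\prod_(j <- L) step_charfun (c j)) * joint_prob J A /\
  \int[P]_w (sin (lin c L w) * joint_indic J A w) = 0.
Proof.
elim: L J A => [|k L IH] J A.
  move=> _ _ okJ; rewrite big_nil mul1r; split.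
    by under eq_Rintegral do rewrite /lin big_nil cos0 mul1r; exact: mean_joint.
  under eq_Rintegral do rewrite /lin big_nil sin0 mul0r.
  exact: mean_cst.
move=> /= /andP[k1 aL] /andP[]; rewrite mem_cat negb_or => /andP[kL kJ] uLJ okJ.
have [hc hs] := IH J A aL uLJ okJ.
have uLJ' : uniq (map Step L ++ Step k :: J).
  by rewrite uniq_catC/= mem_cat negb_or kJ kL /= uniq_catC.
have bJ := bmfun_joint okJ.
have bc : bmfun (fun w => cos (lin c L w) * joint_indic J A w).
  by apply: bmfunM => //; exact: bmfun_cos.
have bs : bmfun (fun w => sin (lin c L w) * joint_indic J A w).
  by apply: bmfunM => //; exact: bmfun_sin.
have ev (g : R -> R) V : continuous g -> measurable V ->
    source_events (Step k) ((fun w => g ((c k)%:R * x k w)) @^-1` V).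
  move=> cg mV; exists ((fun v : borel_rV R dim => g ((c k)%:R * inner theta v)) @^-1` V).
    have mg : measurable_fun setT (fun v : borel_rV R dim => g ((c k)%:R * inner theta v)).
      apply: (measurableT_comp (continuous_measurable_fun cg)).
      by apply: measurable_funM => //; exact: measurable_inner.
    by rewrite -[X in measurable X]setTI; exact: mg.
  by rewrite setTI.
have indc (g : R -> R) : continuous g -> (forall u, `|g u| <= 1) ->
   \int[P]_w ((cos (lin c L w) * joint_indic J A w) * g ((c k)%:R * x k w)) =
   (\int[P]_w g ((c k)%:R * x k w)) * \int[P]_w (cos (lin c L w) * joint_indic J A w) /\
   \int[P]_w ((sin (lin c L w) * joint_indic J A w) * g ((c k)%:R * x k w)) =
   (\int[P]_w g ((c k)%:R * x k w)) * \int[P]_w (sin (lin c L w) * joint_indic J A w).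
  move=> cg g1.
  have mgx : measurable_fun setT (fun w => g ((c k)%:R * x k w)).
    by apply: (measurableT_comp (continuous_measurable_fun cg)); exact: measurable_funM.
  split; apply: mean_mul_indep => // V mV.
  - have [+ _] := IH _ _ aL uLJ' (events_ok_cons okJ kJ k1 (ev g V cg mV)).
    rewrite joint_cons// jointP_cons// => h.
    under eq_Rintegral do rewrite -mulrA.
    by rewrite h hc; ring.
  - have [_ +] := IH _ _ aL uLJ' (events_ok_cons okJ kJ k1 (ev g V cg mV)).
    rewrite joint_cons// => h.
    under eq_Rintegral do rewrite -mulrA.
    by rewrite h hs mulr0.
have [cc sc] := indc _ (@continuous_cos R) (@cos_max R).
have [cs ss] := indc _ (@continuous_sin R) (@sin_max R).
have bcx : bmfun (fun w => cos ((c k)%:R * x k w)) by apply: bmfun_cos; exact: measurable_funM.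
have bsx : bmfun (fun w => sin ((c k)%:R * x k w)) by apply: bmfun_sin; exact: measurable_funM.
rewrite mean_cos_xi// in cc sc; rewrite mean_sin_xi// in cs ss.
split.
  transitivity (\int[P]_w ((cos (lin c L w) * joint_indic J A w) * cos ((c k)%:R * x k w) -
     (sin (lin c L w) * joint_indic J A w) * sin ((c k)%:R * x k w))).
    by apply: eq_Rintegral => w _; rewrite /lin big_cons cosD; ring.
  rewrite meanB; [|exact: bmfunM..].
  by rewrite cc ss hc mul0r subr0 big_cons mulrA.
transitivity (\int[P]_w ((cos (lin c L w) * joint_indic J A w) * sin ((c k)%:R * x k w) +
     (sin (lin c L w) * joint_indic J A w) * cos ((c k)%:R * x k w))).
  by apply: eq_Rintegral => w _; rewrite /lin big_cons sinD; ring.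
rewrite meanD; [|exact: bmfunM..].
by rewrite cs sc hs mul0r mulr0 addr0.
Qed.

End swim.

(** * The characteristic function of the swim *)

Section genealogy.
Context (R : realType) (dim : nat) (alpha p : R).
Context (d : measure_display) (T : measurableType d) (P : probability T R).
Context (xi : nat -> {RV P >-> borel_rV R dim}) (eps : nat -> {RV P >-> bool}).
Context (U : nat -> {RV P >-> nat}) (Y S : nat -> T -> 'rV[R]_dim).
Hypothesis hS : shark_random_swim alpha p xi eps U Y S.
Implicit Types (J : seq source) (A : source -> set T) (w : T).

Local Notation events_ok := (@events_ok R dim d T P xi eps U).
Local Notation joint_indic := (@joint_indic R d T).
Local Notation source_events := (@source_events R dim d T P xi eps U).

(** The label of a step is the time of the innovation that it ultimately copies; [nth] is shifted
    because steps are numbered from 1. *)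
Fixpoint roots (n : nat) w : seq nat :=
  if n is m.+1 then
    rcons (roots m w) (if eps n.+1 w then nth 0 (roots m w) (U n.+1 w).-1 else n.+1)%N
  else [:: 1%N].

Lemma size_roots n w : size (roots n w) = n.+1.
Proof. by elim: n => //= n IH; rewrite size_rcons IH. Qed.

Lemma nth_roots n w i : (1 <= i <= n.+1)%N -> Y i w = xi (nth 0%N (roots n w) i.-1) w.
Proof.
elim: n i => [|n IH] i /andP[i1 ile].
  have -> : i = 1%N by lia.
  by rewrite (srs_Y1 hS).
rewrite /= nth_rcons size_roots; case: ltnP => [lt|ge].
  by apply: IH; lia.
have -> : i = n.+2 by lia.
rewrite eqxx (srs_Y hS)//; case: ifP => // _; apply: IH.
by have := srs_U_range hS w (isT : 2 <= n.+2)%N; lia.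
Qed.

Lemma swim_roots n w : S n.+1 w = \sum_(u <- roots n w) (xi u w : 'rV[R]_dim).
Proof.
rewrite (srs_S hS) [RHS](big_nth 0%N) size_roots big_add1 /=.
by rewrite big_nat [RHS]big_nat; apply: eq_bigr => i /andP[_ il]; rewrite (@nth_roots n).
Qed.

Let coin k b := [set w | eps k w = b].
Let index k u := [set w | U k w = u].

Let coin_event k b : source_events (Coin k) (coin k b).
Proof. by exists [set b] => //; rewrite setTI. Qed.

Let index_event k u : source_events (Index k) (index k u).
Proof. by exists [set u] => //; rewrite setTI. Qed.

Let mcoin k b : measurable (coin k b).
Proof. exact: source_events_measurable (coin_event k b). Qed.

Let mindex k u : measurable (index k u).
Proof. exact: source_events_measurable (index_event k u). Qed.

Lemma roots_step (G : seq nat -> T -> R) n w :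
  G (roots n.+1 w) w =
  G (rcons (roots n w) n.+2) w * \1_(coin n.+2 false) w +
  \sum_(u < n.+1) G (rcons (roots n w) (nth 0%N (roots n w) u)) w *
    (\1_(coin n.+2 true) w * \1_(index n.+2 u.+1) w).
Proof.
rewrite /=; case: (boolP (eps n.+2 w)) => e.
  rewrite [X in _ = _ * X + _]indicE memNset ?mulr0 ?add0r; last first.
    by rewrite /coin/= e.
  have /andP[U1 Un] := srs_U_range hS w (isT : 2 <= n.+2)%N.
  have Ul : ((U n.+2 w).-1 < n.+1)%N by lia.
  rewrite (bigD1 (Ordinal Ul))//= !indicE !mem_set ?mulr1 ?big1 ?addr0//.
  - move=> u uU; rewrite [\1_(index _ _) w]indicE memNset ?mulr0// /index/= => E.
    by move: uU; rewrite -val_eqE/= E eqxx.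
  - by rewrite /index/=; lia.
rewrite big1 ?addr0 => [|u _]; last first.
  by rewrite [\1_(coin _ _) w]indicE memNset ?mul0r ?mulr0// /coin/=; exact/negP.
by rewrite indicE mem_set ?mulr1// /coin/=; exact/negbTE.
Qed.

Lemma measurable_roots (G : seq nat -> T -> R) n : (forall s, measurable_fun setT (G s)) ->
  measurable_fun setT (fun w => G (roots n w) w).
Proof.
elim: n G => [|n IH] G mG; first exact: mG.
under eq_fun do rewrite roots_step.
apply: measurable_funD.
  by apply: measurable_funM; [exact: (IH (fun s => G (rcons s n.+2)))|exact: measurable_indic].
apply: measurable_sum => u; apply: measurable_funM.
  exact: (IH (fun s => G (rcons s (nth 0%N s u)))).
by apply: measurable_funM; exact: measurable_indic.
Qed.

Definition noise_after (m : nat) (i : source) : bool :=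
  match i with Step _ => false | Coin k => (m < k)%N | Index k => (m < k)%N end.

Let prob_coin k b : (2 <= k)%N -> fine (P (coin k b)) = if b then p else 1 - p.
Proof.
move=> k2; have E : P (coin k true) = p%:E by exact: srs_eps hS _ k2.
case: b; first by rewrite E.
have -> : coin k false = ~` coin k true.
  by apply/seteqP; split => w; rewrite /coin/=; case: (eps k w).
by rewrite probability_setC// E.
Qed.

Let prob_index k u : (2 <= k)%N -> (1 <= u < k)%N -> fine (P (index k u)) = k.-1%:R^-1.
Proof. by move=> k2 uk; rewrite (srs_U_uniform hS k2 uk). Qed.

(** The coin and the index of the last step join the list [J] of independent events, so the
    induction hypothesis applies to the genealogy without that step.  The functional [K] may
    depend on the innovations, which is how [<theta, S_n>] itself is treated. *)
Lemma mean_roots n (K : seq nat -> T -> R) J A :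
  (forall s w, `|K s w| <= 1) -> (forall s, measurable_fun setT (K s)) ->
  (forall s J A, labelling n.+1 s -> events_ok J A -> all (noise_after 1) J ->
    \int[P]_w (K s w * joint_indic J A w) = (\int[P]_w K s w) * joint_prob P J A) ->
  events_ok J A -> all (noise_after n.+1) J ->
  \int[P]_w (K (roots n w) w * joint_indic J A w) =
  tree_mean p n (fun s => \int[P]_w K s w) * joint_prob P J A.
Proof.
elim: n K J A => [|n IH] K J A K1 mK HK okJ lJ; first by rewrite HK.
have k2 : (2 <= n.+2)%N by [].
have lJ' : all (noise_after n.+1) J.
  by apply: sub_all lJ => -[k|k|k]//=; lia.
have cJ : Coin n.+2 \notin J.
  by apply/negP => /(allP lJ); rewrite /= ltnn.
have iJ : Index n.+2 \notin J.
  by apply/negP => /(allP lJ); rewrite /= ltnn.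
have icJ : Index n.+2 \notin Coin n.+2 :: J.
  by rewrite inE negb_or iJ andbT; apply/eqP.
have okc b : events_ok (Coin n.+2 :: J) (set_event A (Coin n.+2) (coin n.+2 b)).
  by apply: events_ok_cons => //; exact: coin_event.
have oki u : events_ok (Index n.+2 :: Coin n.+2 :: J)
    (set_event (set_event A (Coin n.+2) (coin n.+2 true)) (Index n.+2) (index n.+2 u)).
  by apply: events_ok_cons => //; exact: index_event.
have bK (G : seq nat -> T -> R) : (forall s w, `|G s w| <= 1) ->
    (forall s, measurable_fun setT (G s)) -> bmfun (fun w => G (roots n w) w).
  by move=> G1 mG; split; [exact: measurable_roots|exists 1 => w; exact: G1].
have step0 : \int[P]_w (K (rcons (roots n w) n.+2) w *
      joint_indic (Coin n.+2 :: J) (set_event A (Coin n.+2) (coin n.+2 false)) w) =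
    tree_mean p n (fun s => \int[P]_w K (rcons s n.+2) w) *
      (joint_prob P J A * (1 - p)).
  rewrite (IH (fun s => K (rcons s n.+2)))//.
  - by rewrite jointP_cons// prob_coin.
  - move=> s J' A' ls; apply: HK; apply: labelling_rcons => //=; lia.
  - by rewrite /= ltnSn lJ'.
have step1 (u : 'I_n.+1) : \int[P]_w (K (rcons (roots n w) (nth 0%N (roots n w) u)) w *
      joint_indic (Index n.+2 :: Coin n.+2 :: J)
        (set_event (set_event A (Coin n.+2) (coin n.+2 true)) (Index n.+2) (index n.+2 u.+1)) w) =
    tree_mean p n (fun s => \int[P]_w K (rcons s (nth 0%N s u)) w) *
      (joint_prob P J A * p * n.+1%:R^-1).
  rewrite (IH (fun s => K (rcons s (nth 0%N s u))))//.
  - by rewrite jointP_cons// jointP_cons// prob_coin// prob_index//= ltnS ltn_ord.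
  - move=> s J' A' ls; apply: HK; apply: labelling_rcons => //=.
    apply: (labelling_mem ls); apply: mem_nth.
    by case/andP: ls => /eqP ->.
  - by rewrite /= ltnSn lJ'.
have b0 : bmfun (fun w => K (rcons (roots n w) n.+2) w *
      joint_indic (Coin n.+2 :: J) (set_event A (Coin n.+2) (coin n.+2 false)) w).
  by apply: bmfunM; [exact: (bK (fun s => K (rcons s n.+2)))|exact: bmfun_joint (okc _)].
have b1 (u : 'I_n.+1) : bmfun (fun w => K (rcons (roots n w) (nth 0%N (roots n w) u)) w *
      joint_indic (Index n.+2 :: Coin n.+2 :: J)
        (set_event (set_event A (Coin n.+2) (coin n.+2 true)) (Index n.+2) (index n.+2 u.+1)) w).
  apply: bmfunM; first exact: (bK (fun s => K (rcons s (nth 0%N s u)))).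
  exact: bmfun_joint (oki _).
transitivity (\int[P]_w (K (rcons (roots n w) n.+2) w *
      joint_indic (Coin n.+2 :: J) (set_event A (Coin n.+2) (coin n.+2 false)) w +
    \sum_(u < n.+1) K (rcons (roots n w) (nth 0%N (roots n w) u)) w *
      joint_indic (Index n.+2 :: Coin n.+2 :: J)
        (set_event (set_event A (Coin n.+2) (coin n.+2 true)) (Index n.+2) (index n.+2 u.+1)) w)).
  apply: eq_Rintegral => w _; rewrite roots_step mulrDl; congr (_ + _).
    by rewrite joint_cons// -!mulrA [X in _ * X]mulrC.
  rewrite mulr_suml; apply: eq_bigr => u _.
  by rewrite joint_cons// joint_cons//; ring.
rewrite meanD//; last exact: bmfun_sum.
rewrite step0 mean_sum//.
under eq_bigr do rewrite step1.
rewrite -mulr_suml -tree_mean_sum mulrA -(mulrA (joint_prob P J A)) [X in _ + X]mulrCA.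
rewrite [tree_mean p n _ * joint_prob P J A]mulrC -!mulrA -mulrDr [RHS]mulrC; congr (_ * _).
rewrite mulrC [X in _ + X]mulrC -!tree_meanZ -tree_meanD /=.
apply: eq_tree_mean => s /andP[/eqP sn _]; rewrite /tree_step.
by rewrite (big_nth 0%N) sn big_mkord.
Qed.

(** Given the genealogy, the cluster sizes multiply independent stable innovations, whose
    characteristic functions multiply to an exponential of [occ]. *)
Theorem mean_trig_swim n (theta : 'rV[R]_dim) :
  [/\ measurable_fun setT (fun w => inner theta (S n.+1 w)),
   \int[P]_w cos (inner theta (S n.+1 w)) =
     tree_mean p n (fun s => expR (- (enorm theta `^ alpha * occ (fun c => c%:R `^ alpha) s))) &
   \int[P]_w sin (inner theta (S n.+1 w)) = 0].
Proof.
pose x j w := inner theta (xi j w).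
have mx j : measurable_fun setT (x j).
  exact: (measurableT_comp (measurable_inner theta)).
pose lin s w := \sum_(u <- s) x u w.
have linE w : inner theta (S n.+1 w) = lin (roots n w) w.
  rewrite swim_roots /lin; elim: (roots n w) => [|u s IH].
    by rewrite !big_nil /inner big1// => i _; rewrite mxE mulr0.
  by rewrite !big_cons innerDr IH.
have mlin s : measurable_fun setT (lin s).
  by apply: measurable_sum.
have linD s w : lin s w = \sum_(j <- undup s) (count_mem j s)%:R * x j w.
  rewrite /lin -[LHS]big_undup_iterop_count; apply: eq_bigr => j _.
  by rewrite mulr_natl.
have ok0 : events_ok [::] (fun=> setT) by [].
have trig s J A : labelling n.+1 s -> events_ok J A -> all (noise_after 1) J ->
   \int[P]_w (cos (lin s w) * joint_indic J A w) =
     expR (- (enorm theta `^ alpha * occ (fun c => c%:R `^ alpha) s)) * joint_prob P J A /\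
   \int[P]_w (sin (lin s w) * joint_indic J A w) = 0.
  move=> ls okJ lJ.
  have aL : all (leq 1) (undup s).
    apply/allP => j; rewrite mem_undup => js.
    by case/andP: ls => _ /allP /(_ _ js) /andP[].
  have uL : uniq (map Step (undup s) ++ J).
    rewrite cat_uniq map_inj_uniq ?undup_uniq ?okJ.1 ?andbT/=; last by move=> i j [].
    apply/hasPn => i /(allP lJ); case: i => //= k _; apply/negP => /mapP[j _]//.
  have [hc hs] := mean_trig_steps hS theta (fun j => count_mem j s) aL uL okJ.
  split.
    under eq_Rintegral do rewrite linD.
    rewrite hc; congr (_ * _).
    by rewrite /step_charfun -expR_sum sumrN -mulr_sumr.
  by under eq_Rintegral do rewrite linD.
have trig0 s : labelling n.+1 s -> \int[P]_w (cos (lin s w)) =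
     expR (- (enorm theta `^ alpha * occ (fun c => c%:R `^ alpha) s)) /\
    \int[P]_w (sin (lin s w)) = 0.
  move=> ls; have [+ +] := trig s _ _ ls ok0 isT.
  rewrite /joint_prob big_nil mulr1 => <- <-.
  by split; apply: eq_Rintegral => w _; rewrite /joint_indic big_nil mulr1.
have red (g : R -> R) : continuous g -> (forall u, `|g u| <= 1) ->
    (forall s J A, labelling n.+1 s -> events_ok J A -> all (noise_after 1) J ->
      \int[P]_w (g (lin s w) * joint_indic J A w) = (\int[P]_w g (lin s w)) * joint_prob P J A) ->
    \int[P]_w g (inner theta (S n.+1 w)) = tree_mean p n (fun s => \int[P]_w g (lin s w)).
  move=> cg g1 Hg.
  have := @mean_roots n (fun s w => g (lin s w)) [::] (fun=> setT) (fun _ _ => g1 _)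
    (fun s => measurableT_comp (continuous_measurable_fun cg) (mlin s)) Hg ok0 isT.
  rewrite /joint_prob big_nil mulr1 => <-.
  by apply: eq_Rintegral => w _; rewrite /joint_indic big_nil mulr1 linE.
split.
- under eq_fun do rewrite linE; exact: measurable_roots.
- rewrite red; [|exact: continuous_cos|exact: cos_max|].
    by apply: eq_tree_mean => s ls; rewrite (trig0 s ls).1.
  by move=> s J A ls okJ lJ; rewrite (trig s J A ls okJ lJ).1 (trig0 s ls).1.
- rewrite red; [|exact: continuous_sin|exact: sin_max|].
    rewrite -[RHS](tree_mean_cst p n); apply: eq_tree_mean => s ls.
    by rewrite (trig0 s ls).2.
  by move=> s J A ls okJ lJ; rewrite (trig s J A ls okJ lJ).2 (trig0 s ls).2 mul0r.
Qed.

End genealogy.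

(** * Asymptotics and conclusion *)

Section asymptotics.
Context {R : realType} (p alpha t : R).
Hypotheses (p01 : 0 < p < 1) (a2 : 0 < alpha <= 2) (ap1 : alpha * p = 1) (t0 : 0 <= t).

Local Notation M := (tree_mean p).
Local Notation W := (occ (fun c => c%:R `^ alpha)).

Definition limit_scale : R := (1 - p) * Gamma (alpha + 1).

Let p01' : 0 <= p <= 1. Proof. by case/andP: p01 => *; apply/andP; split; lra. Qed.
Let a1 : 1 <= alpha.
Proof.
case/andP: p01 => p0 p1; case/andP: a2 => a0 _.
by rewrite -ap1 ler_piMr// ltW.
Qed.

Lemma limit_scale_ge0 : 0 <= limit_scale.
Proof. by rewrite mulr_ge0 ?Gamma_ge0//; case/andP: p01 => *; lra. Qed.

Lemma expRN_lipschitz (u v : R) : 0 <= u -> 0 <= v -> `|expR (- u) - expR (- v)| <= `|u - v|.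
Proof.
wlog uv : u v / u <= v.
  move=> H u0 v0; have [uv|/ltW vu] := leP u v; first exact: H.
  by rewrite distrC [leRHS]distrC; exact: H.
move=> u0 v0; rewrite ger0_norm; last by rewrite subr_ge0 ler_expR lerN2.
rewrite ler0_norm ?subr_le0// opprB.
have -> : expR (- v) = expR (- u) * expR (- (v - u)) by rewrite -expRD; congr expR; ring.
have h : 1 - (v - u) <= expR (- (v - u)) by exact: expR_ge1Dx.
have e1 : expR (- u) <= 1 by rewrite -expR0 ler_expR oppr_le0.
have e0 : 0 < expR (- u) by exact: expR_gt0.
rewrite -[X in X - _]mulr1 -mulrBr.
apply: (@le_trans _ _ (expR (- u) * (v - u))); first by rewrite ler_wpM2l ?(ltW e0)//; lra.
by rewrite ler_piMl//; lra.
Qed.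

(** The derivative of [x ln x] between [x] and [N] is at most [ln N + 1], and [N - x <= 1]. *)
Lemma xlnx_gap (N x : R) : 1 <= x -> x <= N -> N - 1 <= x ->
  `|x * ln x - N * ln N| <= ln N + 1.
Proof.
move=> x1 xN Nx; have x0 : 0 < x by lra.
have N0 : 0 < N by lra.
have lx0 : 0 <= ln x by exact: ln_ge0.
have lxN : ln x <= ln N by rewrite ler_ln.
rewrite ler0_norm; last by rewrite subr_le0 ler_pM// ltW.
have q : x * (ln N - ln x) <= N - x.
  rewrite -ln_div ?posrE//.
  have -> : N / x = 1 + (N / x - 1) by ring.
  have h : ln (1 + (N / x - 1)) <= N / x - 1.
    by apply: le_ln1Dx; have : 0 < N / x by [exact: divr_gt0]; move=> *; lra.
  have := ler_wpM2l (ltW x0) h; rewrite mulrBr mulr1 mulrCA divff ?gt_eqF// mulr1.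
  by move=> *; lra.
have r : (N - x) * ln N <= 1 * ln N by rewrite ler_wpM2r//; lra.
by lra.
Qed.

Definition norming (n : nat) : R := (n%:R `^ t * ln n%:R)^-1.

Definition dev_bound : R :=
  Gamma (alpha + 1) * (2 * Num.sqrt (1 + t) + 1) + 1 + 2 * limit_scale.

Lemma size_bounds n : (1 <= n)%N ->
  [/\ 1 <= (n%:R `^ t : R), (0 < Num.truncn (n%:R `^ t : R))%N,
   (Num.truncn (n%:R `^ t : R))%:R <= (n%:R `^ t : R) &
   (n%:R `^ t : R) - 1 <= (Num.truncn (n%:R `^ t : R))%:R].
Proof.
move=> n1; have n1R : 1 <= n%:R :> R by rewrite ler1n.
have N1 : 1 <= n%:R `^ t :> R by rewrite -[leLHS](powRr0 n%:R) ler_powR.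
split => //.
- by rewrite truncn_gt0.
- by rewrite truncn_le// (le_trans _ N1).
- by have := truncnS_gt (n%:R `^ t : R); rewrite -natr1 => *; lra.
Qed.

(** At time [m = floor (n^t)] the law of large numbers is normalised by [m ln m], which is
    [t n^t ln n] up to an error of at most [ln (n^t) + 1]; the bounds [n^t >= 1] and
    [n^t >= 1 + t ln n] cover [t = 0] and [t > 0] together. *)
Lemma tree_mean_dev n : 1 <= ln (n%:R : R) ->
  M (Num.truncn (n%:R `^ t : R)).-1 (fun s => `|norming n * W s - t * limit_scale|)
  <= dev_bound / Num.sqrt (ln n%:R).
Proof.
move=> l1; set l := ln _ in l1 *.
have n1 : (1 <= n)%N.
  rewrite lt0n; apply/eqP => n0; move: l1; rewrite /l n0.
  by rewrite ln0// ler10.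
have l0 : 0 < l by lra.
have [N1 m0 mN Nm] := size_bounds n1; rewrite /norming -/l.
set N := n%:R `^ t in N1 m0 mN Nm *.
set m := Num.truncn N in m0 mN Nm *.
rewrite -(prednK m0) in mN Nm; set k := m.-1 in mN Nm *.
set x : R := k.+1%:R in mN Nm.
have x1 : 1 <= x by rewrite ler1n.
have lnN : ln N = t * l by rewrite ln_powR.
have G0 := @Gamma_ge0 R (alpha + 1); set G := Gamma _ in G0.
have c0 := limit_scale_ge0; set c := limit_scale in c0 *.
have lam0 : 0 < (N * l)^-1 by rewrite invr_gt0 mulr_gt0//; lra.
set lam := (N * l)^-1 in lam0 *.
have lx0 : 0 <= ln x by exact: ln_ge0.
have lxl : ln x <= t * l by rewrite -lnN ler_ln ?posrE//; lra.
pose r := Num.sqrt l.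
have r0 : 0 < r by rewrite sqrtr_gt0.
have r2 : r * r = l by rewrite -expr2 sqr_sqrtr// ltW.
have r1 : 1 <= r by rewrite -[leLHS]sqrtr1 ler_wsqrtr.
apply: (@le_trans _ _ (M k (fun s =>
   lam * `|W s - c * (x * ln x)| + c * `|lam * (x * ln x) - t|))).
  apply: le_tree_mean => // s _.
  rewrite (_ : lam * W s - t * c = lam * (W s - c * (x * ln x)) + c * (lam * (x * ln x) - t));
    last by ring.
  by rewrite (le_trans (ler_normD _ _))// (normrM lam) (gtr0_norm lam0) (normrM c) (ger0_norm c0).
rewrite tree_meanD tree_mean_cst tree_meanZ.
have B := tree_mean_powR p01 a2 ap1 k a1.
rewrite -/x -/(limit_scale) -/c -/G in B.
have lamx : lam * x <= l^-1.
  rewrite /lam invfM mulrAC -[leRHS]mul1r ler_wpM2r ?invr_ge0 ?(ltW l0)//.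
  by rewrite mulrC ler_pdivrMr ?mul1r//; lra.
have lr : l^-1 <= r^-1 by rewrite lef_pV2 ?posrE// -r2 ler_peMl// ltW.
have first : lam * M k (fun s => `|W s - c * (x * ln x)|) <=
    (G * (2 * Num.sqrt (1 + t) + 1) + 1) / r.
  apply: (le_trans (ler_wpM2l (ltW lam0) B)).
  have s0 : 0 <= Num.sqrt (1 + ln x) by exact: sqrtr_ge0.
  have sq : Num.sqrt (1 + ln x) <= Num.sqrt (1 + t) * r.
    rewrite /r -sqrtrM ?addr_ge0//.
    by apply: ler_wsqrtr; rewrite mulrDl mul1r; lra.
  rewrite mulrA; apply: (@le_trans _ _ (l^-1 * (G * (2 * (Num.sqrt (1 + t) * r) + 1) + 1))).
    apply: ler_pM => //; first by rewrite mulr_ge0 ?(ltW lam0)//; lra.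
      by rewrite addr_ge0// mulr_ge0// addr_ge0// mulr_ge0.
    by rewrite lerD2r ler_wpM2l// lerD2r ler_wpM2l.
  apply: (@le_trans _ _ (l^-1 * (r * (G * (2 * Num.sqrt (1 + t) + 1) + 1)))).
    rewrite ler_wpM2l ?invr_ge0 ?(ltW l0)//.
    rewrite [leRHS](_ : _ = G * (2 * (Num.sqrt (1 + t) * r) + r) + r); last by ring.
    by rewrite lerD// ler_wpM2l// lerD2l.
  by rewrite le_eqVlt -r2; apply/orP; left; apply/eqP; field; rewrite gt_eqF.
have second : `|lam * (x * ln x) - t| <= 2 / r.
  have -> : lam * (x * ln x) - t = lam * (x * ln x - N * ln N).
    by rewrite lnN /lam; field; rewrite !gt_eqF//; lra.
  rewrite normrM (gtr0_norm lam0).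
  apply: (le_trans (ler_wpM2l (ltW lam0) (xlnx_gap x1 mN Nm))).
  rewrite lnN /lam invfM mulrAC.
  apply: (@le_trans _ _ (2 * l^-1)); last by rewrite ler_wpM2l.
  rewrite ler_wpM2r ?invr_ge0 ?(ltW l0)// mulrC ler_pdivrMr; last by lra.
  have : 1 + t * l <= N.
    by rewrite -lnN -[leRHS](@lnK _ N) ?posrE ?expR_ge1Dx//; lra.
  by lra.
apply: (@le_trans _ _ ((G * (2 * Num.sqrt (1 + t) + 1) + 1) / r + c * (2 / r))).
  by apply: lerD; [exact: first|exact: (ler_wpM2l c0 second)].
by rewrite /dev_bound -/G -/c -/r le_eqVlt; apply/orP; left; apply/eqP; ring.
Qed.

Lemma near_ln_ge (B : R) : \forall n \near \oo, B <= ln (n%:R : R).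
Proof.
near=> n; have h : expR B <= n%:R by near: n; exact: nbhs_infty_ger.
by rewrite -[leLHS]expRK ler_ln ?posrE ?expR_gt0// (lt_le_trans (expR_gt0 B)).
Unshelve. all: end_near. Qed.

Lemma tree_mean_dev_cvg0 (e : R) : 0 < e -> \forall n \near \oo,
  M (Num.truncn (n%:R `^ t : R)).-1 (fun s => `|norming n * W s - t * limit_scale|) <= e.
Proof.
move=> e0; near=> n.
have l1 : 1 <= ln (n%:R : R) by near: n; exact: near_ln_ge.
have l2 : (dev_bound / e) ^+ 2 <= ln (n%:R : R) by near: n; exact: near_ln_ge.
apply: (le_trans (tree_mean_dev l1)).
have r0 : 0 < Num.sqrt (ln (n%:R : R)) by rewrite sqrtr_gt0 (lt_le_trans ltr01).
rewrite ler_pdivrMr// mulrC -ler_pdivrMr// -[leLHS]ger0_norm ?normr_id.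
  by rewrite -sqrtr_sqr ler_wsqrtr.
apply: divr_ge0; last exact: ltW.
apply: addr_ge0; last by apply: mulr_ge0 => //; exact: limit_scale_ge0.
apply: addr_ge0 => //; apply: mulr_ge0; first exact: Gamma_ge0.
by apply: addr_ge0 => //; apply: mulr_ge0 => //; exact: sqrtr_ge0.
Unshelve. all: end_near. Qed.

End asymptotics.

Section rescaled.
Context (R : realType) (dim : nat) (alpha p t : R).
Context (d : measure_display) (T : measurableType d) (P : probability T R).
Context (xi : nat -> {RV P >-> borel_rV R dim}) (eps : nat -> {RV P >-> bool}).
Context (U : nat -> {RV P >-> nat}) (Y S : nat -> T -> 'rV[R]_dim).
Hypothesis hS : shark_random_swim alpha p xi eps U Y S.
Hypotheses (p01 : 0 < p < 1) (a2 : 0 < alpha <= 2) (ap1 : alpha * p = 1) (t0 : 0 <= t).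
Implicit Types theta : 'rV[R]_dim.

Definition rescaled (n : nat) (w : T) : 'rV[R]_dim :=
  norming t n `^ (alpha^-1) *: S (Num.truncn (n%:R `^ t : R)) w.

Local Notation W := (occ (fun c => c%:R `^ alpha)).
Local Notation M n := (tree_mean p (Num.truncn (n%:R `^ t : R)).-1).

Let p01' : 0 <= p <= 1. Proof. by case/andP: p01 => *; apply/andP; split; lra. Qed.

Let a0 : 0 < alpha. Proof. by case/andP: a2. Qed.

Lemma measurable_rescaled n theta :
  measurable_fun setT (fun w => inner theta (rescaled n w)).
Proof.
rewrite /rescaled; under eq_fun do rewrite innerZr.
apply: measurable_funM => //.
case: (Num.truncn _) => [|k]; last by have [] := mean_trig_swim hS k theta.
under eq_fun do rewrite (srs_S hS) big_geq//.
exact: measurable_cst.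
Qed.

Lemma mean_trig_rescaled n theta : (1 <= n)%N ->
  \int[P]_w cos (inner theta (rescaled n w)) =
    M n (fun s => expR (- (enorm theta `^ alpha * (norming t n * W s)))) /\
  \int[P]_w sin (inner theta (rescaled n w)) = 0.
Proof.
move=> n1; have [_ m0 _ _] := size_bounds t0 n1.
have s0 : 0 <= norming t n.
  by rewrite /norming invr_ge0 mulr_ge0 ?powR_ge0// ln_ge0// ler1n.
set a := norming t n `^ (alpha^-1).
have E w : inner theta (rescaled n w) =
    inner (a *: theta) (S (Num.truncn (n%:R `^ t : R)).-1.+1 w).
  by rewrite prednK// innerZr innerZl.
have [_ hc hs] := mean_trig_swim hS (Num.truncn (n%:R `^ t : R)).-1 (a *: theta).
split; under eq_Rintegral do rewrite E; last exact: hs.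
have aE : a `^ alpha = norming t n.
  by rewrite /a -powRrM mulVf ?(gt_eqF a0)// powRr1.
have a_ge0 : 0 <= a by exact: powR_ge0.
rewrite hc (enormZ _ a_ge0) (powRM _ a_ge0 (enorm_ge0 _)) aE.
apply: eq_tree_mean => s _; congr expR.
by rewrite mulrAC mulrC; congr (- _); ring.
Qed.

Lemma cvg_cos_rescaled theta : \int[P]_w cos (inner theta (rescaled n w)) @[n --> \oo] -->
  expR (- (enorm theta `^ alpha * (t * limit_scale p alpha))).
Proof.
set r := enorm theta `^ alpha; have r0 : 0 <= r by exact: powR_ge0.
have c0 : 0 <= limit_scale p alpha by exact: limit_scale_ge0.
apply/cvgrPdist_le => e e0.
have e1 : 0 < e / (r + 1) by rewrite divr_gt0//; lra.
near=> n.
have n1 : (1 <= n)%N by near: n; exact: nbhs_infty_ge.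
have s0 : 0 <= norming t n.
  by rewrite /norming invr_ge0 mulr_ge0 ?powR_ge0// ln_ge0// ler1n.
have D : M n (fun s => `|norming t n * W s - t * limit_scale p alpha|) <= e / (r + 1).
  by near: n; exact: tree_mean_dev_cvg0.
rewrite (mean_trig_rescaled _ n1).1 distrC -/r.
rewrite -[X in _ - X](tree_mean_cst p (Num.truncn (n%:R `^ t : R)).-1) -[X in _ + X]mulN1r.
rewrite -tree_meanZ -tree_meanD; apply: (le_trans (ler_norm_tree_mean p01' _ _)).
apply: (@le_trans _ _ (M n (fun s => r * `|norming t n * W s - t * limit_scale p alpha|))).
  apply: le_tree_mean => // s _.
  have W0 : 0 <= W s by apply: occ_ge0 => c; exact: powR_ge0.
  have u0 : 0 <= r * (norming t n * W s) by rewrite mulr_ge0// mulr_ge0.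
  have v0 : 0 <= r * (t * limit_scale p alpha) by rewrite mulr_ge0// mulr_ge0.
  rewrite mulN1r (le_trans (expRN_lipschitz u0 v0))//.
  by rewrite -mulrBr normrM (ger0_norm r0).
rewrite tree_meanZ; apply: (le_trans (ler_wpM2l r0 D)).
rewrite mulrA ler_pdivrMr; last by lra.
by rewrite mulrC ler_wpM2l ?(ltW e0)//; lra.
Unshelve. all: end_near. Qed.

Lemma enorm_delta (v : R) (i : 'I_dim) : 0 <= v -> enorm (v *: delta_mx 0 i : 'rV[R]_dim) = v.
Proof.
by move=> v0; rewrite enormZ// /enorm inner_delta mxE !eqxx sqrtr1 mulr1.
Qed.

Lemma powR_alpha_le (v : R) : 0 < v <= 1 -> v `^ alpha <= v.
Proof.
move=> v01; apply: ge1r_powR => //.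
by case/andP: p01 => p0 p1; rewrite -ap1 ler_piMr// ltW.
Qed.

(** From [1 - exp (- y) <= y] and [v^alpha <= v], the bound follows from that on the mean of
    the rescaled sum of powers. *)
Lemma tight_rescaled : \forall n \near \oo, forall i v, 0 < v <= 1 ->
  \int[P]_w (1 - cos (v * rescaled n w 0 i)) <= (t * limit_scale p alpha + 1) * v.
Proof.
have c0 : 0 <= limit_scale p alpha by exact: limit_scale_ge0.
near=> n => i v v01; have /andP[v0 v1] := v01.
have n1 : (1 <= n)%N by near: n; exact: nbhs_infty_ge.
have s0 : 0 <= norming t n.
  by rewrite /norming invr_ge0 mulr_ge0 ?powR_ge0// ln_ge0// ler1n.
have D : M n (fun s => `|norming t n * W s - t * limit_scale p alpha|) <= 1.
  by near: n; exact: tree_mean_dev_cvg0.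
have E w : v * rescaled n w 0 i = inner (v *: delta_mx 0 i) (rescaled n w).
  by rewrite innerZl inner_delta.
under eq_Rintegral do rewrite E.
have bc : bmfun (fun w => cos (inner (v *: delta_mx 0 i) (rescaled n w))).
  by apply: bmfun_cos; exact: measurable_rescaled.
rewrite (meanB P (bmfun_cst _ 1) bc) (mean_cst P) (mean_trig_rescaled _ n1).1.
rewrite enorm_delta ?(ltW v0)//; set r := v `^ alpha.
have r0 : 0 <= r by exact: powR_ge0.
have rv : r <= v by exact: powR_alpha_le.
rewrite -[X in X - _](tree_mean_cst p (Num.truncn (n%:R `^ t : R)).-1) -[X in _ + X]mulN1r.
rewrite -tree_meanZ -tree_meanD.
apply: (@le_trans _ _ (M n (fun s => r * (`|norming t n * W s - t * limit_scale p alpha| +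
    t * limit_scale p alpha)))).
  apply: le_tree_mean => // s _; rewrite mulN1r lerBlDr -lerBlDl.
  apply: le_trans (expR_ge1Dx _); rewrite lerD2l lerN2 ler_wpM2l//.
  by rewrite -lerBlDr ler_norm.
rewrite tree_meanZ tree_meanD tree_mean_cst [leRHS]mulrC.
apply: ler_pM => //; last by rewrite addrC lerD2l.
apply: addr_ge0; last exact: mulr_ge0.
rewrite -[leLHS](tree_mean_cst p (Num.truncn (n%:R `^ t : R)).-1).
exact: (le_tree_mean p01').
Unshelve. all: end_near. Qed.

End rescaled.

Theorem theorem3 (R : realType) (dim : nat) (alpha p t : R)
    (hdim : (1 <= dim)%N)
    (halpha : 0 < alpha <= 2)
    (hp : 0 < p < 1)
    (halphap : alpha * p = 1)
    (ht : 0 <= t)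
    (d : measure_display) (T : measurableType d) (P : probability T R)
    (xi : nat -> {RV P >-> borel_rV R dim})
    (eps : nat -> {RV P >-> bool})
    (U : nat -> {RV P >-> nat})
    (Y S : nat -> T -> 'rV[R]_dim)
    (hS : shark_random_swim alpha p xi eps U Y S)
    (d' : measure_display) (T' : measurableType d') (Q : probability T' R)
    (Stilde : {RV Q >-> borel_rV R dim})
    (hStilde : forall theta : 'rV[R]_dim,
       charfun Q Stilde theta =
       ((expR (- ((1 - p) * Gamma (alpha + 1) * enorm theta `^ alpha)))%:C)%C) :
  cvg_in_distribution P
    (fun (n : nat) (w : T) =>
       ((n%:R `^ t * ln n%:R)^-1) `^ (alpha^-1) *:
         S (Num.truncn (n%:R `^ t : R)) w)
    Q (fun w : T' => t `^ (alpha^-1) *: (Stilde w : 'rV[R]_dim)).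
Proof.
have a0 : 0 < alpha by case/andP: halpha.
have c0 : 0 <= limit_scale p alpha by exact: limit_scale_ge0.
pose Z w := t `^ (alpha^-1) *: (Stilde w : 'rV[R]_dim).
have ZE theta w : inner theta (Z w) = inner (t `^ (alpha^-1) *: theta) (Stilde w).
  by rewrite innerZr innerZl.
have mZ theta : measurable_fun setT (fun w => inner theta (Z w)).
  under eq_fun do rewrite ZE.
  exact: (measurableT_comp (measurable_inner _)).
have cosZ theta : \int[Q]_w cos (inner theta (Z w)) =
    expR (- (enorm theta `^ alpha * (t * limit_scale p alpha))).
  under eq_Rintegral do rewrite ZE.
  have [-> _] := hStilde (t `^ (alpha^-1) *: theta); congr (expR (- _)).
  rewrite enormZ ?powR_ge0// powRM ?powR_ge0 ?enorm_ge0// -powRrM mulVf ?gt_eqF// powRr1//.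
  by rewrite /limit_scale; ring.
have sinZ theta : \int[Q]_w sin (inner theta (Z w)) = 0.
  under eq_Rintegral do rewrite ZE.
  by have [_ ->] := hStilde (t `^ (alpha^-1) *: theta).
have mX := measurable_rescaled t hS.
apply: (@levy_continuity _ _ _ _ _ P Q dim (rescaled alpha t S) Z
  (t * limit_scale p alpha + 1)) => //.
- exact: tight_rescaled hS hp halpha halphap ht.
- move=> i v v01; have /andP[v0 v1] := v01.
  have E w : v * Z w 0 i = inner (v *: delta_mx 0 i) (Z w).
    by rewrite innerZl inner_delta.
  under eq_Rintegral do rewrite E.
  rewrite (meanB Q (bmfun_cst _ 1) (bmfun_cos (mZ _))) (mean_cst Q) cosZ.
  rewrite enorm_delta ?(ltW v0)//.
  rewrite lerBlDr -lerBlDl; apply: le_trans (expR_ge1Dx _); rewrite lerD2l lerN2.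
  rewrite [leRHS]mulrC; apply: ler_pM; [exact: powR_ge0|exact: mulr_ge0| |by rewrite lerDl].
  by apply: (@powR_alpha_le R alpha p).
- move=> theta b.
  have cD d0 (T0 : measurableType d0) (P0 : probability T0 R) (y : T0 -> R) :
      measurable_fun setT y ->
      \int[P0]_w cos (y w + b) = cos b * \int[P0]_w cos (y w) - sin b * \int[P0]_w sin (y w).
    move=> my; have bc := bmfun_cos my; have bs := bmfun_sin my.
    rewrite -(meanZ P0 _ bc) -(meanZ P0 _ bs) -(meanB P0 (bmfunZ _ bc) (bmfunZ _ bs)).
    by apply: eq_Rintegral => w _; rewrite cosD; ring.
  rewrite (cD _ _ Q) ?sinZ ?cosZ//.
  have cvs : \int[P]_w sin (inner theta (rescaled alpha t S n w)) @[n --> \oo] --> (0 : R).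
    apply: cvg_near_cst; near=> n.
    have n1 : (1 <= n)%N by near: n; exact: nbhs_infty_ge.
    by have [_ ->] := mean_trig_rescaled hS halpha ht theta n1.
  under eq_cvg do rewrite (cD _ _ P _ (mX _ theta)).
  apply: cvgB; first by apply: cvgMr; exact: cvg_cos_rescaled hS hp halpha halphap ht theta.
  exact: cvgMr.
Unshelve. all: end_near. Qed.
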